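(* Let $f\in\mathrm{Diff}^1_{\mathrm{tw}}(\mathbf{T}^2)$ be area-preserving, and suppose that $\rho_V(\widehat f)=\{\alpha\}$ for some $\alpha\notin\mathbb{Q}$, where $\widehat f\in \mathrm{Diff}^1_{\mathrm{tw}}(\mathbf{T}^1\times\mathbb{R})$ is a lift of $f$. Let $\mathcal{F}_G=\{\mathrm{Graph}(\phi_t)\}_{t\in\mathbf{T}^1}$ be the $f$-invariant foliation of $\mathbf{T}^2$ by graphs of uniformly Lipschitz functions (which exists under these hypotheses). Assume also that $\mathcal{F}_G$ is Lipschitz and that the map $\psi:\mathbf{T}^1\to\mathbf{T}^1$ induced by $f$ on the space of leaves of $\mathcal{F}_G$ is bi-Lipschitz conjugate to the irrational rotation $R_\alpha:t\mapsto t+\alpha \bmod 1$. Then $f$ is minimal (every orbit is dense in $\mathbf{T}^2$).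
   Context: $\mathbf{T}^1=\mathbb{R}/\mathbb{Z}$, $\mathbf{T}^2=\mathbb{R}^2/\mathbb{Z}^2$; $p_1,p_2$ are the projections on the first and second coordinates. $\mathrm{Diff}^1_{\mathrm{tw}}(\mathbf{T}^2)$ is the set of $C^1$-diffeomorphisms $f$ of $\mathbf{T}^2$ which, for some $\ell\in\mathbb{Z}\setminus\{0\}$, are homotopic to the Dehn twist $(x,y)\mapsto(x+\ell y \bmod 1, y\bmod 1)$ and satisfy the twist condition: there is $k_{tw}>0$ such that for any lift $\widetilde f:\mathbb{R}^2\to\mathbb{R}^2$ of $f$, $\frac{\ell}{|\ell|}\frac{\partial (p_1\circ\widetilde f)}{\partial \widetilde y}(\widetilde x,\widetilde y)>k_{tw}$ for all $(\widetilde x,\widetilde y)\in\mathbb{R}^2$. $\mathrm{Diff}^1_{\mathrm{tw}}(\mathbf{T}^1\times\mathbb{R})$ is the set of lifts of such maps to $\mathbf{T}^1\times\mathbb{R}$. Area-preserving means preserving Lebesgue measure. The vertical rotation set is $\rho_V(\widehat f)=\bigcap_{i\ge1}\overline{\bigcup_{n\ge i}\left\{\frac{p_2\circ\widehat f^n(\widehat z)-p_2(\widehat z)}{n}:\widehat z\in\mathbf{T}^1\times\mathbb{R}\right\}}\subset\mathbb{R}$. $\mathcal{F}_G$ denotes a foliation of $\mathbf{T}^2$ by simple closed curves, all homotopic to $(1,0)$, each of which is the graph of a $K$-Lipschitz function $\phi_t:\mathbf{T}^1\to\mathbf{T}^1$ of the $x$-coordinate, with one constant $K>0$ for all leaves.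 It is $f$-invariant if $f$ maps leaves onto leaves. $\widehat{\mathcal F}_G$ is its lift to $\mathbf{T}^1\times\mathbb{R}$. $\mathcal{F}_G$ is Lipschitz if there is $K_{Fol}>0$ such that for any two leaves of $\widehat{\mathcal F}_G$, graphs of functions $\widehat g_1,\widehat g_2:\mathbf{T}^1\to\mathbb{R}$, and all $x,x'\in\mathbf{T}^1$, $\frac{1}{K_{Fol}}|\widehat g_1(x')-\widehat g_2(x')|\le|\widehat g_1(x)-\widehat g_2(x)|\le K_{Fol}|\widehat g_1(x')-\widehat g_2(x')|$. The leaves are parametrized so that $\phi_t(0)=t$ for $t\in\mathbf{T}^1$; the map induced by $f$ on the space of leaves is the homeomorphism $\psi:\mathbf{T}^1\to\mathbf{T}^1$ given by $f(\mathrm{Graph}(\phi_t))=\mathrm{Graph}(\phi_{\psi(t)})$. Bi-Lipschitz conjugate to $R_\alpha$ means that there is a bi-Lipschitz homeomorphism $h_1$ of $\mathbf{T}^1$ with $h_1\circ\psi=R_\alpha\circ h_1$. *)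

(* Defs.v *)
From HB Require Import structures.
From mathcomp Require Import all_boot all_order all_algebra generic_quotient.
From mathcomp Require Import all_classical all_reals all_analysis.

Set Implicit Arguments.
Unset Strict Implicit.
Unset Printing Implicit Defensive.
Import Order.TTheory GRing.Theory Num.Theory.
Import numFieldNormedType.Exports.

Local Open Scope classical_set_scope.
Local Open Scope ring_scope.
Local Open Scope quotient_scope.

Section Circle.
Variable R : realType.

Definition modZ : rel R := fun x y => x - y \is a Num.int.

Lemma modZ_refl : reflexive modZ.
Proof. by move=> x; rewrite /modZ subrr rpred0. Qed.

Lemma modZ_sym : symmetric modZ.
Proof. by move=> x y; rewrite /modZ -opprB rpredN. Qed.

Lemma modZ_trans : transitive modZ.
Proof. by move=> y x z xy yz; rewrite /modZ -(subrKA y) rpredD. Qed.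

Definition modZ_equiv := EquivRel modZ modZ_refl modZ_sym modZ_trans.

Definition circle := {eq_quot modZ_equiv}.

HB.instance Definition _ := Quotient.on circle.
HB.instance Definition _ := Topological.copy circle (quotient_topology circle).

Definition circle_proj (x : R) : circle := \pi_circle x.

Lemma circle_projP (x y : R) :
  circle_proj x = circle_proj y <-> exists k : int, x = y + k%:~R.
Proof.
split=> [/eqmodP/intrP[k xyk]|[k ->]].
  by exists k; rewrite -xyk addrCA subrr addr0.
by apply/eqmodP; rewrite /= /modZ addrC addKr rpred_int.
Qed.

Definition circle_dist (a b : circle) : R :=
  inf [set r | exists x y, [/\ circle_proj x = a, circle_proj y = b
                             & r = `|x - y|]].

Definition rotation (alpha : R) (t : circle) : circle :=
  circle_proj (repr t + alpha).

Lemma rotationE (alpha x : R) :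
  rotation alpha (circle_proj x) = circle_proj (x + alpha).
Proof.
apply/circle_projP.
have /circle_projP[k ->] : circle_proj (repr (circle_proj x)) = circle_proj x.
  by rewrite /circle_proj reprK.
by exists k; rewrite addrAC.
Qed.

End Circle.

Notation torus R := (circle R * circle R)%type.
Notation annulus R := (circle R * R)%type.

Definition homotopic (R : realType) (X Y : topologicalType) (f g : X -> Y) :=
  exists H : R * X -> Y,
    [/\ {within (`[0, 1] : set R) `*` [set: X], continuous H},
        forall x, H (0, x) = f x & forall x, H (1, x) = g x].

Definition homeomorphism (X Y : topologicalType) (h : X -> Y) :=
  continuous h /\ exists h' : Y -> X, [/\ cancel h h', cancel h' h & continuous h'].

Section TorusMaps.
Variable R : realType.

Definition torus_proj (z : R * R) : torus R :=
  (circle_proj z.1, circle_proj z.2).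

Definition annulus_proj (z : annulus R) : torus R := (z.1, circle_proj z.2).

Definition plane_lift (F : R * R -> R * R) (f : torus R -> torus R) :=
  continuous F /\ forall z, torus_proj (F z) = f (torus_proj z).

Definition annulus_lift (fhat : annulus R -> annulus R)
    (f : torus R -> torus R) :=
  continuous fhat /\ forall z, annulus_proj (fhat z) = f (annulus_proj z).

Definition C1_plane (F : R * R -> R * R) :=
  (forall z, differentiable F z) /\
  (forall v, continuous (fun z => 'd F z v)).

(* The covering is a local diffeomorphism and any two lifts of f differ by an
   element of Z^2, so it does not matter which lift is tested. *)
Definition C1_torus (f : torus R -> torus R) :=
  exists2 F, plane_lift F f & C1_plane F.

Definition C1_diffeo (f : torus R -> torus R) :=
  C1_torus f /\
  exists g : torus R -> torus R, [/\ cancel f g, cancel g f & C1_torus g].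

Definition dehn_twist (l : int) (z : torus R) : torus R :=
  (circle_proj (repr z.1 + l%:~R * repr z.2), z.2).

Lemma dehn_twistE (l : int) (x y : R) :
  dehn_twist l (torus_proj (x, y)) = torus_proj (x + l%:~R * y, y).
Proof.
congr pair; apply/circle_projP => /=.
have /circle_projP[k ->] : circle_proj (repr (circle_proj x)) = circle_proj x.
  by rewrite /circle_proj reprK.
have /circle_projP[m ->] : circle_proj (repr (circle_proj y)) = circle_proj y.
  by rewrite /circle_proj reprK.
by exists (k + l * m); rewrite mulrDr addrACA intrD intrM.
Qed.

Definition twist_condition (l : int) (f : torus R -> torus R) :=
  exists2 k_tw : R, 0 < k_tw & forall F, plane_lift F f ->
    forall z, k_tw < (l%:~R / `|l%:~R|) * 'D_(0, 1) (fun w => (F w).1) z.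

Definition Diff1_tw (f : torus R -> torus R) :=
  C1_diffeo f /\
  exists l : int, [/\ l != 0, homotopic R f (dehn_twist l)
                    & twist_condition l f].

(* Lebesgue measure on the torus: the image of the Lebesgue measure of the
   fundamental domain [0, 1[^2. *)
Definition torus_lebesgue (A : set (torus R)) : \bar R :=
  (@lebesgue_measure R \x @lebesgue_measure R)%E
    ((`[0, 1[ `*` `[0, 1[) `&` torus_proj @^-1` A).

Definition area_preserving (f : torus R -> torus R) :=
  forall A : set (torus R), <<s [set U : set (torus R) | open U] >> A ->
    torus_lebesgue (f @^-1` A) = torus_lebesgue A.

Definition vertical_rotation_set (fhat : annulus R -> annulus R) : set R :=
  \bigcap_(i in [set i | (1 <= i)%N])
    closure (\bigcup_(n in [set n | (i <= n)%N])
      [set ((iter n fhat z).2 - z.2) / n%:R | z in [set: annulus R]]).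

Definition orbit_of (f : torus R -> torus R) (z : torus R) : set (torus R) :=
  [set w | exists n : nat, w = iter n f z \/ iter n f w = z].

Definition minimal (f : torus R -> torus R) :=
  forall z, dense (orbit_of f z).

End TorusMaps.

Section Foliations.
Variable R : realType.

(* U is the domain of a foliated chart c, with inverse c', whose plaques (the
   components of the traces of the leaves on U) are the horizontal segments. *)
Definition foliated_chart (leaves : set (set (torus R))) (U : set (torus R))
    (c : torus R -> R * R) (c' : R * R -> torus R) :=
  let box : set (R * R) := (`]0, 1[ `*` `]0, 1[) in
  [/\ open U,
      c @` U = box /\ (forall w, U w -> c' (c w) = w),
      {within U, continuous c},
      {within box, continuous c'}
    & forall L w, leaves L -> L w -> U w ->
        connected_component (L `&` U) w = [set w' | U w' /\ (c w').2 = (c w).2]].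

Definition foliation (leaves : set (set (torus R))) :=
  [/\ forall L, leaves L -> L !=set0 /\ connected L,
      forall L L', leaves L -> leaves L' -> L `&` L' !=set0 -> L = L',
      forall z, exists2 L, leaves L & L z
    & forall z, exists U c c', U z /\ foliated_chart leaves U c c'].

Definition circle_graph (g : circle R -> circle R) : set (torus R) :=
  [set z | z.2 = g z.1].

Definition uniformly_lipschitz (phi : circle R -> circle R -> circle R) :=
  exists2 K : R, 0 < K & forall t x x',
    circle_dist (phi t x) (phi t x') <= K * circle_dist x x'.

Definition lipschitz_graph_foliation (phi : circle R -> circle R -> circle R) :=
  [/\ foliation [set circle_graph (phi t) | t in [set: circle R]],
      forall t, homotopic R (fun x => (x, phi t x))
                            (fun x => (x, circle_proj 0)),
      uniformly_lipschitz phi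
    & forall t, phi t (circle_proj 0) = t].

Definition invariant_foliation (f : torus R -> torus R)
    (phi : circle R -> circle R -> circle R) :=
  forall t, exists s, f @` circle_graph (phi t) = circle_graph (phi s).

(* As the leaves are homotopic to (1, 0), the leaves of the lifted foliation
   are the graphs of the continuous lifts of the maps phi t. *)
Definition lifted_leaf (phi : circle R -> circle R -> circle R)
    (g : circle R -> R) :=
  continuous g /\ exists t, forall x, circle_proj (g x) = phi t x.

Definition lipschitz_foliation (phi : circle R -> circle R -> circle R) :=
  exists2 K_fol : R, 0 < K_fol & forall g1 g2,
    lifted_leaf phi g1 -> lifted_leaf phi g2 -> forall x x',
    K_fol^-1 * `|g1 x' - g2 x'| <= `|g1 x - g2 x| <= K_fol * `|g1 x' - g2 x'|.

Definition induced_leaf_map (f : torus R -> torus R)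
    (phi : circle R -> circle R -> circle R) (psi : circle R -> circle R) :=
  forall t, f @` circle_graph (phi t) = circle_graph (phi (psi t)).

Definition bilipschitz_homeo (h : circle R -> circle R) :=
  homeomorphism h /\ exists2 L : R, 0 < L & forall a b,
    L^-1 * circle_dist a b <= circle_dist (h a) (h b) <= L * circle_dist a b.

Definition bilipschitz_conjugate (psi rho : circle R -> circle R) :=
  exists2 h : circle R -> circle R, bilipschitz_homeo h & h \o psi = rho \o h.

End Foliations.

(* Main.v *)
Require Import Defs.
From HB Require Import structures.
From mathcomp Require Import all_boot all_order all_algebra generic_quotient.
From mathcomp Require Import all_classical all_reals all_analysis.
From mathcomp Require Import measurable_realfun ring lra zify.
Import Order.TTheory GRing.Theory Num.Theory.
Import numFieldNormedType.Exports.
Local Open Scope classical_set_scope.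
Local Open Scope ring_scope.
Set Implicit Arguments.
Unset Strict Implicit.
Unset Printing Implicit Defensive.

(** In the coordinates [(x, t)], where [t] is the parameter of the leaf through a
    point and [x] its abscissa, [f] lifts to a skew product
    [(x, t) |-> (A x t, Psi t)] of the plane, where [Psi] lifts the map induced
    on the leaves ([leaf_dynamics_exist]). The homotopy to the Dehn twist makes
    [A] increasing in [x] and commute with the translation by one; the twist
    condition, together with the Lipschitz property of the foliation, makes [A]
    strictly monotone in [t], at a definite speed. Write [A_n x t] for the
    position along the leaf after [n] steps.

    Two uniform estimates follow. First, the iterates of [f] do not contract the
    leaves: [A_n b t - A_n a t >= (b - a) / K] with [K] independent of [n]
    ([leafwise_expansion]). Indeed a thin box between two nearby leaves has an
    area comparable to the product of its length along the leaves and its width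
    across them, and so has its image; the areas are equal, and the widths are
    comparable because the induced map is bi-Lipschitz conjugate to a rotation.
    Second, for [t < t'] fixed, [A_n x t' - A_n x t] grows at least linearly in
    absolute value ([leafwise_drift]): each iteration adds a definite shear, of
    constant sign, which the following iterations do not contract by more than
    the factor [K].

    Suppose that the orbit of [z] avoids an open set, hence a small box
    [|x - x0| < rho], [|t - t0| < r] in leaf coordinates. The images of the box
    contain strips of half-width [eps = rho / K] along the leaves, whose centre
    lines [t |-> A_n x0 t] wind around the leaves as [n] grows; as the orbit is
    invariant, it avoids them too. On the other hand the orbit meets a dense set
    of leaves, so when the leaves are covered by finitely many arcs of length
    [eps], the orbit meets one of these arcs on a set of leaves that is dense in
    some interval [J] ([finite_union_somewhere_dense]). For a suitable large [n]
    the [n]-th image of the box lies over [J], and its centre line crosses the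
    chosen arc; on a nearby leaf the orbit meets the strip, which is absurd. *)

(** * The circle as a quotient of the line *)

Section CircleBasics.
Variable R : realType.
Implicit Types (x y z e : R) (k : int).

Local Notation pi := (@circle_proj R).

Lemma circle_proj_continuous : continuous pi.
Proof. exact: (@pi_continuous R (circle R)). Qed.

Lemma circle_proj_surj (a : circle R) : exists x, pi x = a.
Proof. by exists (repr a); rewrite /circle_proj reprK. Qed.

Lemma circle_projD x k : pi (x + k%:~R) = pi x.
Proof. by apply/circle_projP; exists k. Qed.

Lemma circle_proj_open (O : set R) : open O -> open (pi @` O).
Proof.
move=> oO; change (open (pi @^-1` (pi @` O))).
rewrite [X in open X](_ : _ = \bigcup_(k in [set: int])
    ((fun y => y + k%:~R) @^-1` O)); last first.
  apply/seteqP; split=> [y [x Ox /circle_projP[k xy]]|y [k _ /= Ok]].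
    by exists k => //=; rewrite -xy.
  by exists (y + k%:~R) => //; rewrite circle_projD.
apply: bigcup_open => k _.
have /continuousP : continuous (fun y : R => y + k%:~R).
  by move=> y; apply: cvgD; [exact: cvg_id|exact: cvg_cst].
exact.
Qed.

Lemma circle_continuous (T : topologicalType) (g : circle R -> T) :
  continuous (g \o pi) -> continuous g.
Proof. by move=> cg; apply/quotient_continuous. Qed.

(** Around a point [p], a continuous circle-valued map has values close to any
    given lift of its value at [p]. *)
Lemma circle_near (T : topologicalType) (c : T -> circle R) (p : T) u e :
  {for p, continuous c} -> c p = pi u -> 0 < e ->
  \forall q \near p, exists2 d, `|d| < e & c q = pi (u + d).
Proof.
move=> cp cu e0.
have oB : open (pi @` ball u e) by apply: circle_proj_open; exact: ball_open.
have nB : nbhs (c p) (pi @` ball u e).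
  apply: open_nbhs_nbhs; split => //.
  by exists u => //; exact: ballxx.
have nq : \forall q \near p, (pi @` ball u e) (c q) by exact: (cp _ nB).
near=> q; have [v uv vq] : (pi @` ball u e) (c q) by near: q.
exists (v - u); last by rewrite addrC subrK.
by move: uv; rewrite /ball /= distrC.
Unshelve. all: by end_near. Qed.

Lemma intr_norm_ge1 k : k != 0 -> 1 <= `|k%:~R : R|.
Proof.
by move=> k0; rewrite -intr_norm -[1]/(1%:~R) ler_int -gtz0_ge1 normr_gt0.
Qed.

Lemma circle_dist_le x y k : circle_dist (pi x) (pi y) <= `|x - y - k%:~R|.
Proof.
apply: inf_lbound; first by exists 0 => _ [? [? [_ _ ->]]].
exists x, (y + k%:~R); split => //; first by rewrite circle_projD.
by rewrite opprD addrA.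
Qed.

Lemma circle_dist_leB x y : circle_dist (pi x) (pi y) <= `|x - y|.
Proof. by have := circle_dist_le x y 0; rewrite subr0. Qed.

(** The distance of two classes is reached on a pair of representatives at
    distance at most 1/2. *)
Lemma circle_dist_attained x y :
  exists2 k : int, circle_dist (pi x) (pi y) = `|x - y - k%:~R|
    & `|x - y - k%:~R| <= 2^-1.
Proof.
set z := x - y.
pose k := Num.floor (z + 2^-1).
have /andP[kz zk] : k%:~R <= z + 2^-1 < (k + 1)%:~R by exact: floor_itv.
rewrite intrD in zk.
have zk2 : `|z - k%:~R| <= 2^-1 by rewrite ler_norml; apply/andP; split; lra.
exists k => //; apply/eqP; rewrite eq_le circle_dist_le /=.
apply: lb_le_inf; first by exists `|x - y|, x, y.
move=> _ [x' [y' [/circle_projP[i ->] /circle_projP[j ->] ->]]].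
have -> : x + i%:~R - (y + j%:~R) = (z - k%:~R) + (k + i - j)%:~R.
  by rewrite /z !intrD mulrNz; ring.
set m := (k + i - j); have [->|m0] := eqVneq m 0; first by rewrite addr0.
have m1 := intr_norm_ge1 m0.
have : `|m%:~R| <= `|z - k%:~R + m%:~R| + `|z - k%:~R|.
  have := ler_normB (z - k%:~R + m%:~R) (z - k%:~R).
  by rewrite [X in `|X| <= _](_ : _ = m%:~R) //; ring.
lra.
Qed.

Lemma circle_dist_small x y : `|x - y| <= 2^-1 ->
  circle_dist (pi x) (pi y) = `|x - y|.
Proof.
move=> xy; apply/eqP; rewrite eq_le circle_dist_leB /=.
have [k -> h] := circle_dist_attained x y.
have [->|k0] := eqVneq k 0; first by rewrite subr0.
have := intr_norm_ge1 k0.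
have : `|k%:~R| <= `|x - y - k%:~R| + `|x - y|.
  have := ler_normB (x - y) (x - y - k%:~R).
  by rewrite [X in `|X| <= _](_ : _ = k%:~R) 1?addrC //; ring.
lra.
Qed.

Lemma circle_dist_gt0 x y : pi x <> pi y -> 0 < circle_dist (pi x) (pi y).
Proof.
move=> xy; have [k -> _] := circle_dist_attained x y.
rewrite normr_gt0; apply/eqP => h; apply: xy.
by apply/circle_projP; exists k; lra.
Qed.

(** A continuous integer-valued function on a segment is constant. *)
Lemma int_valued_const (f : R -> R) (a b : R) : a <= b ->
  {within `[a, b], continuous f} ->
  (forall x, x \in `[a, b] -> f x \is a Num.int) -> f a = f b.
Proof.
move=> ab cf fi.
have aab : a \in `[a, b] by rewrite in_itv /= lexx ab.
have bab : b \in `[a, b] by rewrite in_itv /= lexx ab.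
have /intrP[m fm] := fi a aab; have /intrP[n fn] := fi b bab.
have [|nm0] := eqVneq (n - m) 0; first by move/subr0_eq => mn; rewrite fm fn mn.
have h1 := intr_norm_ge1 nm0; rewrite intrD mulrNz in h1.
(* between [f a] and [f b] there is a value at distance 1/2 from [f a] *)
pose e : R := if f a <= f b then 2^-1 else - 2^-1.
have e1 : `|e| < 1 by rewrite /e; case: ifP => _; rewrite ?normrN ger0_norm; lra.
have e0 : `|e| != 0.
  by rewrite normr_eq0 /e; case: ifP => _; rewrite ?oppr_eq0 invr_eq0 pnatr_eq0.
have [|c cab fc] := @IVT R f a b (f a + e) ab cf.
  move: h1; rewrite -fn -fm ge_min le_max /e.
  case: (leP (f a) (f b)) => h.
    rewrite ger0_norm ?subr_ge0// => h1.
    by apply/andP; split; apply/orP; [left|right]; lra.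
  rewrite ltr0_norm ?subr_lt0// => h1.
  by apply/andP; split; apply/orP; [right|left]; lra.
have /intrP[k fk] := fi c cab.
have /intr_norm_ge1 : k - m != 0.
  rewrite subr_eq0; apply: contraNneq e0 => km; rewrite normr_eq0.
  by apply/eqP; move: fc; rewrite fk km fm; lra.
by rewrite intrD mulrNz -fk fc fm addrAC subrr add0r leNgt e1.
Qed.
End CircleBasics.

(** * Lifting paths and homotopies to the line *)

Section Lifting.
Variable R : realType.
Implicit Types (x y z e : R) (k : int).

Local Notation pi := (@circle_proj R).

(** The signed length, at least -1/2 and less than 1/2, of the short arc from
    [a] to [b]. *)
Definition arc_diff (a b : circle R) : R :=
  let z := repr b - repr a in z - (Num.floor (z + 2^-1))%:~R.

Lemma arc_diff_proj x (a b : circle R) : pi x = a -> pi (x + arc_diff a b) = b.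
Proof.
move=> xa; rewrite /arc_diff /=.
have ra : pi (repr a) = pi x by rewrite xa /circle_proj reprK.
have rb : pi (repr b) = b by rewrite /circle_proj reprK.
have /circle_projP[k ->] := ra.
rewrite -[RHS]rb; apply/circle_projP; eexists (- k - Num.floor _).
by rewrite intrD !mulrNz; ring.
Qed.

Lemma arc_diffE x d : `|d| < 2^-1 -> arc_diff (pi x) (pi (x + d)) = d.
Proof.
rewrite ltr_norml => /andP[d1 d2]; rewrite /arc_diff /=.
have /circle_projP[k ->] : pi (repr (pi x)) = pi x by rewrite /circle_proj reprK.
have /circle_projP[m ->] : pi (repr (pi (x + d))) = pi (x + d).
  by rewrite /circle_proj reprK.
have -> : Num.floor (x + d + m%:~R - (x + k%:~R) + 2^-1) = m - k.
  by apply/eqP; rewrite floor_eq !intrD mulrNz mulr1z; apply/andP; split; lra.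
by rewrite intrD mulrNz; ring.
Qed.

Lemma continuous_pair (S T U : topologicalType) (f : S -> T) (g : S -> U) :
  continuous f -> continuous g -> continuous (fun p => (f p, g p)).
Proof. by move=> cf cg p; exact: (cvg_pair (cf p) (cg p)). Qed.

Lemma continuous_compT (S T U : topologicalType) (f : S -> T) (g : T -> U) :
  continuous f -> continuous g -> continuous (fun p => g (f p)).
Proof. by move=> cf cg p; exact: (continuous_comp (cf p) (cg (f p))). Qed.

Lemma continuous_pairr (T : topologicalType) (K : R * R -> T) (t : R) :
  continuous K -> continuous (fun x => K (t, x)).
Proof.
move=> cK; apply: continuous_compT cK; apply: continuous_pair => x.
- exact: cvg_cst.
- exact: cvg_id.
Qed.

(** Uniformly in [x] on a compact set, a small change of the homotopy parameter
    moves the point by less than a quarter of a turn. *)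
Lemma homotopy_step (K : R * R -> circle R) (B : R) : continuous K ->
  exists2 d : R, 0 < d & forall x t t', `|x| <= B -> 0 <= t <= 1 ->
    `|t' - t| < d -> exists u e, [/\ K (t, x) = pi u, K (t', x) = pi (u + e)
                                    & `|e| < 4^-1].
Proof.
move=> cK.
pose P (d : R) (p : R * R) := forall t', `|t' - p.1| < d ->
  exists u e, [/\ K p = pi u, K (t', p.2) = pi (u + e) & `|e| < 4^-1].
have cA : compact (`[0, 1] `*` `[- B, B] : set (R * R)).
  exact: (compact_setX (@segment_compact R 0 1) (@segment_compact R (- B) B)).
have H := (compact_near_coveringP _).1 cA _ (0^'+) P _.
have {}H : \forall d \near 0^'+, `[0, 1]%classic `*` `[- B, B]%classic `<=` P d.
  apply: H => p _.
  have [u pu] := circle_proj_surj (K p).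
  have e8 : 0 < 8^-1 :> R by rewrite invr_gt0.
  have [r /= r0 rK] : exists2 r : R, 0 < r & forall q, `|p.1 - q.1| < r ->
      `|p.2 - q.2| < r -> exists2 e, `|e| < 8^-1 & K q = pi (u + e).
    have := circle_near (cK p) (esym pu) e8.
    move=> /nbhs_ballP[r r0 rK]; exists r => // q q1 q2.
    by apply: rK; split.
  have r20 : 0 < r / 2 by rewrite divr_gt0.
  exists (ball p (r / 2), [set d : R | d < r / 2]).
    by split; [exact: nbhsx_ballx|exact: nbhs_right_lt].
  move=> [q d] /= [[q1 q2] dr] t' t'q.
  rewrite /ball /= in q1 q2.
  have [|| e1 e1r e1K] := rK q; [lra..|].
  have [|| e2 e2r e2K] := rK (t', q.2) => /=; last 1 first.
  - exists (u + e1), (e2 - e1); split => //.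
      by rewrite e2K; congr circle_proj; ring.
    by have := ler_normB e2 e1; lra.
  - have := ler_distD q.1 p.1 t'; rewrite (distrC q.1); lra.
  - by lra.
have [d d0 dP] : exists2 d : R, 0 < d &
    `[0, 1]%classic `*` `[- B, B]%classic `<=` P d.
  near (0:R)^'+ => d; exists d; first by near: d; exact: nbhs_right_gt.
  by near: d.
exists d => // x t t' xB t01 tt'.
by apply: (dP (t, x)) => //; split => //=; rewrite in_itv //= -ler_norml.
Unshelve. all: by end_near. Qed.

(** The sum of the signed displacements along a fine subdivision of the
    homotopy parameter turns a lift of [K (0, _)] into a lift of [K (1, _)];
    it only depends on the path followed by the point. *)
Lemma homotopy_lift (K : R * R -> circle R) (B : R) : continuous K ->
  exists D : R -> R,
    [/\ forall x, `|x| <= B -> {for x, continuous D},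
        forall x u, `|x| <= B -> pi u = K (0, x) -> pi (u + D x) = K (1, x)
      & forall x y, (forall t, K (t, x) = K (t, y)) -> D x = D y].
Proof.
move=> cK; have [d d0 dK] := homotopy_step B cK.
pose N := (Num.truncn d^-1).+1.
have N0 : 0 < N%:R :> R by rewrite ltr0n.
have Nd : N%:R^-1 < d.
  by rewrite invf_plt ?posrE//; apply: truncnS_gt.
pose s (i : nat) : R := i%:R / N%:R.
pose D x := \sum_(i < N) arc_diff (K (s i, x)) (K (s i.+1, x)).
exists D; split=> [x xB|x u xB xu|x y xy]; last 1 first.
- by apply: eq_bigr => i _; rewrite !xy.
- rewrite /continuous_at /D.
  have AC : continuous (fun q : R * R => q.1 + q.2) by exact: add_continuous.
  apply: (@cvg_big R 'I_N +%R 0 xpredT AC R (nbhs x) (index_enum 'I_N)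
     (fun (i : 'I_N) x => arc_diff (K (s i, x)) (K (s i.+1, x)))
     (fun (i : 'I_N) => arc_diff (K (s i, x)) (K (s i.+1, x))) _) => i _.
  have si : 0 <= s i <= 1.
    rewrite divr_ge0// ?ler0n// ler_pdivrMr// mul1r ler_nat.
    exact: ltnW (ltn_ord i).
  have [|u [e [xu xe e4]]] := dK x (s i) (s i.+1) xB si.
    rewrite /s -mulrBl -natrB// subSnn mul1r gtr0_norm// invr_gt0.
    by [].
  rewrite /continuous_at xu xe arc_diffE; last by lra.
  apply/cvgrPdist_lt => eps eps0.
  pose eta := Num.min (eps / 2) 8^-1.
  have eta0 : 0 < eta by rewrite lt_min divr_gt0//= invr_gt0.
  have h1 := circle_near (@continuous_pairr _ K (s i) cK x) xu eta0.
  have h2 := circle_near (@continuous_pairr _ K (s i.+1) cK x) xe eta0.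
  near=> x'.
  have [a1 a1e ->] : exists2 d, `|d| < eta & K (s i, x') = pi (u + d) by near: x'.
  have [a2 a2e ->] : exists2 d, `|d| < eta & K (s i.+1, x') = pi (u + e + d).
    by near: x'.
  have -> : u + e + a2 = u + a1 + (e + a2 - a1) by ring.
  move: a1e a2e; rewrite !lt_min => /andP[a1e a1e'] /andP[a2e a2e'].
  rewrite arc_diffE.
    by rewrite !ltr_norml in a1e a2e *; lra.
  by rewrite !ltr_norml in a1e a2e a1e' a2e' e4 *; lra.
- suff H j : (j <= N)%N -> pi (u + \sum_(i < j)
      arc_diff (K (s i, x)) (K (s i.+1, x))) = K (s j, x).
    by rewrite H//; congr (K (_, _)); rewrite /s divff// gt_eqF.
  elim: j => [_|j IH jN]; first by rewrite big_ord0 addr0 /s mul0r.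
  rewrite big_ord_recr /= addrA; apply: arc_diff_proj.
  exact: IH (ltnW jN).
Unshelve. all: by end_near. Qed.

(** Two lifts of the same path differ by a constant. *)
Lemma lift_diff_const (k k' : R -> R) (B x : R) : `|x| <= B ->
  (forall x, `|x| <= B -> {for x, continuous k}) ->
  (forall x, `|x| <= B -> {for x, continuous k'}) ->
  (forall x, `|x| <= B -> pi (k x) = pi (k' x)) ->
  k x - k' x = k 0 - k' 0.
Proof.
move=> xB ck ck' kk'.
have B0 : 0 <= B by exact: le_trans (normr_ge0 _) xB.
have H (a b : R) : a <= b -> `|a| <= B -> `|b| <= B ->
    k a - k' a = k b - k' b.
  move=> ab aB bB.
  have cB y : y \in `[a, b] -> `|y| <= B.
    rewrite in_itv /= => /andP[ay yb]; move: aB bB; rewrite !ler_norml.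
    by move=> /andP[? ?] /andP[? ?]; apply/andP; split; lra.
  apply: (int_valued_const ab (f := fun y => k y - k' y)) => [|y /cB yB].
    apply: continuous_in_subspaceT => y; rewrite inE => /cB yB.
    by apply: cvgB; [exact: ck|exact: ck'].
  by have /circle_projP[m ->] := kk' _ yB; rewrite addrAC subrr add0r intr_int.
have [x0|/ltW x0] := leP x 0; last apply/esym; by apply: H; rewrite ?normr0.
Qed.

(** Freely homotopic loops in the circle have the same degree. *)
Lemma homotopy_degree (K : R * R -> circle R) (k0 k1 : R -> R) :
  continuous K -> continuous k0 -> continuous k1 ->
  (forall x, pi (k0 x) = K (0, x)) -> (forall x, pi (k1 x) = K (1, x)) ->
  (forall t, K (t, 1) = K (t, 0)) ->
  k0 1 - k0 0 = k1 1 - k1 0.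
Proof.
move=> cK ck0 ck1 k0K k1K K1.
have [D [cD DK DE]] := homotopy_lift 1 cK.
have := @lift_diff_const k1 (fun x => k0 x + D x) 1 1.
rewrite normr1 lexx => /(_ isT) H.
have D10 : D 1 = D 0 by exact: DE.
have {}H : k1 1 - (k0 1 + D 1) = k1 0 - (k0 0 + D 0).
  apply: H => x xB; first exact: ck1.
    by apply: cvgD; [exact: ck0|exact: cD].
  by rewrite k1K; apply/esym/DK.
by rewrite D10 in H; lra.
Qed.

Lemma path_lift (c : R -> circle R) (u : R) : continuous c -> pi u = c 0 ->
  exists k : R -> R, [/\ continuous k, k 0 = u & forall x, pi (k x) = c x].
Proof.
move=> cc u0.
(* lift on each segment [[- n, n]] by contracting it to the origin, then glue
   the lifts, which agree because they have the same value at 0 *)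
have H (n : nat) : exists k : R -> R,
    [/\ forall x, `|x| <= n%:R -> {for x, continuous k}, k 0 = u
      & forall x, `|x| <= n%:R -> pi (k x) = c x].
  have cK : continuous (fun p : R * R => c (p.1 * p.2)).
    by move=> p; apply: continuous_comp; [exact: mul_continuous|exact: cc].
  have [D [cD DK DE]] := homotopy_lift n%:R cK.
  exists (fun x => u + D x - D 0); split => [x xn||x xn].
  - by apply: cvgB; [apply: cvgD; [exact: cvg_cst|exact: cD]|exact: cvg_cst].
  - by rewrite addrK.
  - have := DK x u xn; rewrite /= mul0r mul1r => /(_ u0) <-.
    have := DK 0 u; rewrite normr0 ler0n /= mul0r mul1r -u0.
    move=> /(_ isT erefl)/circle_projP[m /(canRL (addKr _)) ->].
    by rewrite addrA addNr add0r -mulrNz circle_projD.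
have [k kP] := choice H.
have kE (n m : nat) x : `|x| <= n%:R -> `|x| <= m%:R -> k n x = k m x.
  move=> xn xm; have [ckn kn0 knc] := kP n; have [ckm km0 kmc] := kP m.
  have := @lift_diff_const (k n) (k m) `|x| x (lexx _).
  rewrite kn0 km0 subrr => h; apply/subr0_eq; apply: h => y yx.
  - exact: ckn (le_trans yx xn).
  - exact: ckm (le_trans yx xm).
  - by rewrite knc ?kmc// ?(le_trans yx xn)// (le_trans yx xm).
pose N x := (Num.truncn `|x|).+1.
have xN x : `|x| < (N x)%:R by exact: truncnS_gt.
exists (fun x => k (N x) x); split => [x||x].
- have [ck _ _] := kP (N x).
  have cx := ck x (ltW (xN x)).
  rewrite /continuous_at.
  apply: (cvg_trans _ cx); apply: near_eq_cvg.
  have nx : `|y| @[y --> x] --> `|x| by exact: norm_continuous.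
  near=> y; apply: kE; apply/ltW; last exact: xN.
  near: y; exact: (cvgr_lt _ nx).
- by have [_ ->] := kP (N 0).
- by have [_ _ ->] := kP (N x); last exact: ltW.
Unshelve. all: by end_near. Qed.

End Lifting.

(** * Lifts of the leaves *)

Section HomotopyDegree.
Variable R : realType.
Local Notation pi := (@circle_proj R).

Lemma continuous_within_comp (S T U : topologicalType) (A : set T)
    (H : T -> U) (m : S -> T) :
  {within A, continuous H} -> continuous m -> (forall p, A (m p)) ->
  continuous (fun p => H (m p)).
Proof.
move=> cH cm mA p V nV.
have hW : within A (nbhs (m p)) [set x | V (H x)].
  exact: ((@subspace_continuousP T A U H).1 cH (m p) (mA p) V nV).
have h : \forall q \near p, A (m q) -> V (H (m q)) by exact: (cm p _ hW).
change (\forall q \near p, V (H (m q))).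
near=> q; have hq : A (m q) -> V (H (m q)) by near: q.
exact: hq (mA q).
Unshelve. all: by end_near. Qed.

(** The retraction of the line onto the unit interval. *)
Definition clamp (t : R) : R := (`|t| - `|t - 1| + 1) / 2.

Lemma clamp_itv t : 0 <= clamp t <= 1.
Proof.
rewrite /clamp; have [t0|t0] := leP 0 t; last first.
  by rewrite ltr0_norm// ltr0_norm; lra.
have [t1|t1] := leP 1 t; first by rewrite !ger0_norm; lra.
by rewrite ger0_norm// ltr0_norm; lra.
Qed.

Lemma clamp0 : clamp 0 = 0.
Proof. by rewrite /clamp normr0 !sub0r normrN normr1; lra. Qed.

Lemma clamp1 : clamp 1 = 1.
Proof. by rewrite /clamp normr1 subrr normr0; lra. Qed.

Lemma clamp_continuous : continuous clamp.
Proof.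
move=> t; apply: cvgM; last exact: cvg_cst.
apply: cvgD; last exact: cvg_cst.
apply: cvgB; first exact: norm_continuous.
by apply: cvg_norm; apply: cvgB; [exact: cvg_id|exact: cvg_cst].
Qed.

(** Homotopic maps send a loop to loops whose images under a circle-valued
    map have the same degree. *)
Lemma homotopic_degree (X Y : topologicalType) (f g : X -> Y) (c : R -> X)
    (p : Y -> circle R) (k0 k1 : R -> R) :
  homotopic R f g -> continuous c -> c 1 = c 0 -> continuous p ->
  continuous k0 -> continuous k1 ->
  (forall x, pi (k0 x) = p (f (c x))) -> (forall x, pi (k1 x) = p (g (c x))) ->
  k0 1 - k0 0 = k1 1 - k1 0.
Proof.
move=> [H [cH H0 H1]] cc c10 cp ck0 ck1 k0p k1p.
apply: (@homotopy_degree R (fun q => p (H (clamp q.1, c q.2)))) => //.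
- apply: (@continuous_compT _ _ _ (fun q => H (clamp q.1, c q.2))) => //.
  apply: (continuous_within_comp cH) => [|q]; last first.
    by split => //=; rewrite in_itv /=; exact: clamp_itv.
  apply: continuous_pair.
    by apply: continuous_compT clamp_continuous => q; exact: cvg_fst.
  by apply: continuous_compT cc => q; exact: cvg_snd.
- by move=> x; rewrite clamp0 H0.
- by move=> x; rewrite clamp1 H1.
- by move=> t /=; rewrite c10.
Qed.

End HomotopyDegree.

Section LeafLifts.
Variable R : realType.
Local Notation pi := (@circle_proj R).
Implicit Types (phi : circle R -> circle R -> circle R) (g : R -> R -> R).

(** [g t] is the function whose graph is the lift to the plane of the leaf
    [phi (pi t)] through [(0, t)]; the leaves are ordered by [t], and their mutual
    vertical distances are comparable, up to the factor [C], to those measured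
    on the axis [x = 0]. *)
Record leaf_lifts phi g (C : R) : Prop := LeafLifts {
  leaf_gt0 : 0 < C;
  leaf_proj : forall t x, pi (g t x) = phi (pi t) (pi x);
  leaf_at0 : forall t, g t 0 = t;
  leaf_continuous : forall t, continuous (g t);
  leaf_periodic : forall t x (k : int), g t (x + k%:~R) = g t x;
  leaf_shift : forall t x (k : int), g (t + k%:~R) x = g t x + k%:~R;
  leaf_ge : forall t t' x, t <= t' -> (t' - t) / C <= g t' x - g t x;
  leaf_le : forall t t' x, t <= t' -> g t' x - g t x <= C * (t' - t) }.

Lemma circle_dist_cvg (T : topologicalType) (c : T -> circle R) (p : T) :
  (forall e, 0 < e -> \forall q \near p, circle_dist (c q) (c p) < e) ->
  {for p, continuous c}.
Proof.
have [u uE] := circle_proj_surj (c p).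
move=> H V; rewrite -uE => nV.
have /nbhs_ballP[e /= e0 eV] : nbhs u (pi @^-1` V).
  exact: (@circle_proj_continuous R u).
change (\forall q \near p, V (c q)).
have Hp := H e e0.
near=> q; have qe : circle_dist (c q) (c p) < e by near: q.
have [v vE] := circle_proj_surj (c q).
move: qe; rewrite -uE -vE; have [k -> _] := circle_dist_attained v u => vue.
rewrite -(circle_projD v (- k)); apply: eV.
rewrite /ball /= distrC; move: vue; rewrite mulrNz.
by rewrite (_ : v - u - k%:~R = v - k%:~R - u)//; ring.
Unshelve. all: by end_near. Qed.

Lemma shift_int (f : R -> R) (c : R) : (forall x, f (x + 1) = f x + c) ->
  forall x (k : int), f (x + k%:~R) = f x + c * k%:~R.
Proof.
move=> fc.
have fn x (n : nat) : f (x + n%:R) = f x + c * n%:R.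
  elim: n => [|n IH]; first by rewrite mulr0 !addr0.
  by rewrite -natr1 addrA fc IH; ring.
move=> x [n|n]; first exact: fn.
rewrite NegzE mulrNz; have := fn (x - n.+1%:R) n.+1.
by rewrite subrK => ->; rewrite mulrN; ring.
Qed.

(** The lifts of the leaves are periodic since the leaves are homotopic to
    [(1, 0)]; hence they are lifted leaves over the circle, to which the
    Lipschitz property of the foliation applies. Two of them never meet, so
    that their order is the one on the axis. *)
Lemma leaf_lifts_exist phi :
  lipschitz_graph_foliation phi -> lipschitz_foliation phi ->
  exists g C, leaf_lifts phi g C.
Proof.
move=> [_ hphi [K K0 Klip] phi0] [C C0 CP].
have cphi t : continuous (fun x => phi t (pi x)).
  move=> x; apply: circle_dist_cvg => e e0.
  have Ke : 0 < e / K by rewrite divr_gt0.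
  near=> y; apply: le_lt_trans (Klip _ _ _) _.
  rewrite mulrC -ltr_pdivlMr//.
  apply: le_lt_trans (circle_dist_leB _ _) _.
  rewrite distrC; near: y; exact: nbhsx_ballx.
have gP t : exists k : R -> R, [/\ continuous k, k 0 = t
    & forall x, pi (k x) = phi (pi t) (pi x)].
  by apply: path_lift; [exact: cphi|rewrite phi0].
have [g {}gP] := choice gP.
have cg t : continuous (g t) by have [] := gP t.
have g0 t : g t 0 = t by have [] := gP t.
have gproj t x : pi (g t x) = phi (pi t) (pi x) by have [_ _ ->] := gP t.
have pi1 : pi 1 = pi 0 by rewrite -[X in pi X]add0r (circle_projD 0 1).
have g1 t : g t 1 = g t 0.
  have := homotopic_degree (hphi (pi t)) (@circle_proj_continuous R) pi1
    (p := @snd _ _) _ (cg t) (k1 := fun=> 0).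
  move=> /(_ _ _ _ _)/=; rewrite subrr => H.
  apply/subr0_eq/H => //; first by move=> q; exact: cvg_snd.
  by move=> q; exact: cvg_cst.
have gper1 t x : g t (x + 1) = g t x + 0.
  have := @lift_diff_const R (fun x => g t (x + 1)) (g t) `|x| x (lexx _).
  rewrite add0r g1 subrr => H; rewrite addr0; apply/subr0_eq; apply: H => y _.
  - by apply: continuous_comp; [apply: cvgD; [exact: cvg_id|exact: cvg_cst]|exact: cg].
  - exact: cg.
  - by rewrite !gproj (circle_projD _ 1).
have gper t x (k : int) : g t (x + k%:~R) = g t x.
  by rewrite (shift_int (gper1 t)) mul0r addr0.
have gshift t x (k : int) : g (t + k%:~R) x = g t x + k%:~R.
  have := @lift_diff_const R (g (t + k%:~R)) (g t) `|x| x (lexx _).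
  rewrite !g0 => H.
  suff : g (t + k%:~R) x - g t x = t + k%:~R - t by move=> ?; lra.
  apply: H => y _; [exact: cg|exact: cg|].
  by rewrite !gproj circle_projD.
have E t x : g t (repr (pi x)) = g t x.
  have /circle_projP[k ->] : pi (repr (pi x)) = pi x by rewrite /circle_proj reprK.
  by rewrite gper.
have lift t : lifted_leaf phi (fun a => g t (repr a)).
  split; last first.
    exists (pi t) => a; have [x <-] := circle_proj_surj a.
    by rewrite E gproj.
  apply: circle_continuous.
  rewrite [X in continuous X](_ : _ = g t); first exact: cg.
  by apply/funext => x /=; rewrite E.
have glip t t' x : C^-1 * `|t' - t| <= `|g t' x - g t x| <= C * `|t' - t|.
  by have := CP _ _ (lift t') (lift t) (pi x) (pi 0); rewrite !E !g0.
have gpos t t' x : t <= t' -> 0 <= g t' x - g t x.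
  rewrite le_eqVlt => /predU1P[->|tt']; first by rewrite subrr.
  rewrite leNgt; apply/negP => lt0.
  pose f y := g t' y - g t y.
  have cf : continuous f by move=> y; apply: cvgB; exact: cg.
  have [c fc] : exists c, f c = 0.
    have [x0|x0] := leP 0 x.
      have [||c _ fc] := @IVT R f 0 x 0 x0; last by exists c.
        exact: continuous_subspaceT.
      by rewrite ge_min le_max /f !g0; apply/andP; split; apply/orP; [right|left]; lra.
    have [||c _ fc] := @IVT R f x 0 0 (ltW x0); last by exists c.
      exact: continuous_subspaceT.
    by rewrite ge_min le_max /f !g0; apply/andP; split; apply/orP; [left|right]; lra.
  have /andP[+ _] := glip t t' c; rewrite -/(f c) fc normr0 leNgt.
  by rewrite mulr_gt0// ?invr_gt0// gtr0_norm; lra.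
exists g, C; split => //.
- move=> t t' x tt'; have /andP[+ _] := glip t t' x.
  by rewrite (ger0_norm (gpos t t' x tt')) ger0_norm ?subr_ge0// mulrC.
- move=> t t' x tt'; have /andP[_] := glip t t' x.
  by rewrite (ger0_norm (gpos t t' x tt')) ger0_norm ?subr_ge0.
Unshelve. all: by end_near. Qed.

End LeafLifts.

Section LeafChart.
Variable R : realType.
Local Notation pi := (@circle_proj R).
Variables (phi : circle R -> circle R -> circle R) (g : R -> R -> R) (C : R).
Hypothesis gP : leaf_lifts phi g C.

Lemma leaf_lt t t' x : t < t' -> g t x < g t' x.
Proof.
move=> tt'; rewrite -subr_gt0; apply: lt_le_trans (leaf_ge gP x (ltW tt')).
by rewrite divr_gt0 ?subr_gt0// (leaf_gt0 gP).
Qed.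

Lemma leaf_inj x : injective (g ^~ x).
Proof.
move=> t t' /= tt'; apply/eqP; rewrite eq_le !leNgt.
by apply/andP; split; apply/negP => /(@leaf_lt _ _ x); rewrite tt' ltxx.
Qed.

Lemma leaf_normB t t' x : `|g t' x - g t x| <= C * `|t' - t|.
Proof.
have [tt'|/ltW tt'] := leP t t'.
  have h := leaf_le gP x tt'; have h' := leaf_ge gP x tt'.
  rewrite !ger0_norm ?subr_ge0//; rewrite -subr_ge0; apply: le_trans h'.
  by rewrite divr_ge0 ?subr_ge0// (ltW (leaf_gt0 gP)).
have h := leaf_le gP x tt'; have h' := leaf_ge gP x tt'.
rewrite distrC (distrC t') !ger0_norm ?subr_ge0//; rewrite -subr_ge0.
by apply: le_trans h'; rewrite divr_ge0 ?subr_ge0// (ltW (leaf_gt0 gP)).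
Qed.

Lemma leaf_normB_ge t t' x : `|t' - t| <= C * `|g t' x - g t x|.
Proof.
have C0 := leaf_gt0 gP.
wlog tt' : t t' / t <= t' => [H|].
  by have [|/ltW] := leP t t'; [exact: H|rewrite distrC (distrC (g t' x)); exact: H].
have h' := leaf_ge gP x tt'.
rewrite ger0_norm ?subr_ge0// mulrC -ler_pdivrMr//.
by apply: le_trans h' _; exact: ler_norm.
Qed.

Lemma leaf_joint_continuous : continuous (fun p : R * R => g p.2 p.1).
Proof.
move=> p; apply/cvgrPdist_lt => e e0.
have C0 := leaf_gt0 gP.
have e2 : 0 < e / 2 by rewrite divr_gt0.
have e2C : 0 < e / 2 / C by rewrite divr_gt0.
have c1 : continuous (fun q : R * R => g p.2 q.1).
  apply: continuous_compT (leaf_continuous gP (t := p.2)) => q; exact: cvg_fst.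
have h1 : \forall q \near p, `|g p.2 p.1 - g p.2 q.1| < e / 2.
  exact: (cvgrPdist_lt _ _).1 (c1 p) _ e2.
have h2 : \forall q \near p, `|p.2 - q.2| < e / 2 / C.
  have c2 : (fun q : R * R => q.2) @ p --> p.2 by exact: cvg_snd.
  exact: (cvgrPdist_lt _ _).1 c2 _ e2C.
near=> q.
have q1 : `|g p.2 p.1 - g p.2 q.1| < e / 2 by near: q.
have q2 : `|p.2 - q.2| < e / 2 / C by near: q.
have h3 := leaf_normB q.2 p.2 q.1.
have h4 : C * `|p.2 - q.2| < e / 2 by rewrite mulrC -ltr_pdivlMr.
have := ler_distD (g p.2 q.1) (g p.2 p.1) (g q.2 q.1).
by lra.
Unshelve. all: by end_near. Qed.

(** The parametrized leaves sweep out the plane, and the parameter of the leaf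
    through a point is a continuous function of the point. *)
Lemma leaf_index_exists : exists T : R * R -> R,
  [/\ continuous T, forall z, g (T z) z.1 = z.2 & forall x t, T (x, g t x) = t].
Proof.
have C0 := leaf_gt0 gP.
have H z : exists t, g t z.1 = z.2.
  case: z => x y /=.
  pose k := Num.floor (y - g 0 x).
  have /andP[kz zk] : k%:~R <= y - g 0 x < (k + 1)%:~R by exact: floor_itv.
  have h1 : g k%:~R x = g 0 x + k%:~R by rewrite -[X in g X]add0r (leaf_shift gP).
  have h2 : g (k + 1)%:~R x = g 0 x + (k + 1)%:~R.
    by rewrite -[X in g X]add0r (leaf_shift gP).
  have kk : k%:~R <= (k + 1)%:~R :> R by rewrite ler_int lerDl.
  have [||t _ ty] := @IVT R (g ^~ x) _ _ y kk; last by exists t.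
    apply: continuous_subspaceT => t.
    apply: (@continuous_compT _ _ _ (fun t => (x, t)) (fun p : R * R => g p.2 p.1)).
      by apply: continuous_pair => u; [exact: cvg_cst|exact: cvg_id].
    exact: leaf_joint_continuous.
  by rewrite ge_min le_max h1 h2; apply/andP; split; apply/orP; [left|right]; lra.
have [T TP] := choice H.
exists T; split => // [z|x t]; last first.
  by apply: (@leaf_inj x); rewrite -[x in LHS]/((x, g t x).1) TP.
apply/cvgrPdist_lt => e e0.
have e2C : 0 < e / C by rewrite divr_gt0.
have c1 : continuous (fun q : R * R => g (T z) q.1 - q.2).
  move=> q; apply: cvgB; last exact: cvg_snd.
  apply: (continuous_compT _ (leaf_continuous gP (t := T z))) => r; exact: cvg_fst.
have h1 : \forall q \near z, `|0 - (g (T z) q.1 - q.2)| < e / C.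
  have {}c1 : (fun q : R * R => g (T z) q.1 - q.2) @ z --> (0 : R).
    by have := c1 z; rewrite /continuous_at TP subrr.
  exact: (cvgrPdist_lt _ _).1 c1 _ e2C.
near=> q; apply: le_lt_trans (leaf_normB_ge _ _ q.1) _.
rewrite TP mulrC -ltr_pdivlMr// -normrN -sub0r.
by near: q.
Unshelve. all: by end_near. Qed.

Lemma leaf_disjoint a b c : phi a c = phi b c -> a = b.
Proof.
have [s <-] := circle_proj_surj a; have [t <-] := circle_proj_surj b.
have [x <-] := circle_proj_surj c.
rewrite -!(leaf_proj gP) => /circle_projP[k].
by rewrite -(leaf_shift gP) => /leaf_inj ->; rewrite circle_projD.
Qed.

End LeafChart.

(** * Plane lifts of the torus map *)

Section PlaneLifts.
Variable R : realType.
Local Notation pi := (@circle_proj R).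

Lemma int_valued_const_plane (f : R * R -> R) : continuous f ->
  (forall z, f z \is a Num.int) -> forall z, f z = f (0, 0).
Proof.
move=> cf fi z; pose k r := f (r * z.1, r * z.2).
have -> : f z = k 1 by rewrite /k !mul1r -surjective_pairing.
have -> : f (0, 0) = k 0 by rewrite /k !mul0r.
apply/esym/int_valued_const => // [|r _]; last exact: fi.
apply: continuous_subspaceT.
apply: (@continuous_compT _ _ _ (fun r : R => (r * z.1, r * z.2)) f) => //.
by apply: continuous_pair => r; apply: cvgM;
  (exact: cvg_id || exact: cvg_cst).
Qed.

Lemma continuous_inj_monotone (f : R -> R) : continuous f -> injective f ->
  (forall x y, x < y -> f x < f y) \/ (forall x y, x < y -> f y < f x).
Proof.
move=> cf fi.
have [||fm|fm] := @itv_continuous_inj_mono R f (Interval -oo%O +oo%O).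
- exact: continuous_subspaceT.
- by move=> x y _ _; exact: fi.
- by left => x y xy; apply: fm; rewrite ?in_itv.
- by right => x y xy; apply: fm; rewrite ?in_itv.
Qed.

Lemma torus_proj_eq (z w : R * R) : torus_proj z = torus_proj w ->
  exists k l : int, z = (w.1 + k%:~R, w.2 + l%:~R).
Proof.
move=> [/circle_projP[k zk] /circle_projP[l zl]]; exists k, l.
by rewrite -zk -zl; case: z {zk zl}.
Qed.

(** The composition of lifts of a bijection and of its inverse is a
    translation. *)
Lemma plane_lift_inj (f g : torus R -> torus R) (F G : R * R -> R * R) :
  cancel f g -> plane_lift F f -> plane_lift G g -> injective F.
Proof.
move=> fK [cF Ff] [cG Gg].
have GF z : torus_proj (G (F z)) = torus_proj z by rewrite Gg Ff fK.
have cGF : continuous (fun z => G (F z)) by exact: continuous_compT cF cG.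
have H1 z : (G (F z)).1 - z.1 = (G (F (0, 0))).1 - 0.
  apply: (int_valued_const_plane (f := fun z => (G (F z)).1 - z.1)) => [{}z|{}z].
    apply: cvgB; last exact: cvg_fst.
    by apply: (continuous_compT cGF) => w; exact: cvg_fst.
  by have [k [l ->]] := torus_proj_eq (GF z); rewrite addrAC subrr add0r intr_int.
have H2 z : (G (F z)).2 - z.2 = (G (F (0, 0))).2 - 0.
  apply: (int_valued_const_plane (f := fun z => (G (F z)).2 - z.2)) => [{}z|{}z].
    apply: cvgB; last exact: cvg_snd.
    by apply: (continuous_compT cGF) => w; exact: cvg_snd.
  by have [k [l ->]] := torus_proj_eq (GF z); rewrite addrAC subrr add0r intr_int.
move=> [x y] [x' y'] e.
have := H1 (x, y); have := H1 (x', y'); have := H2 (x, y); have := H2 (x', y').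
by rewrite e /= => h1 h2 h3 h4; congr pair; lra.
Qed.

(** The homotopy to a Dehn twist forces a lift to commute with the horizontal
    translation by one. *)
Lemma dehn_lift_shift (f : torus R -> torus R) (F : R * R -> R * R) (l : int) :
  plane_lift F f -> homotopic R f (dehn_twist l) ->
  forall x y, (F (x + 1, y)).1 = (F (x, y)).1 + 1.
Proof.
move=> [cF Ff] hf x y.
have cF1 : continuous (fun z => (F z).1).
  by apply: continuous_compT cF _ => z; exact: cvg_fst.
have pi1 z : pi (z + 1) = pi z by exact: (circle_projD z 1).
have H z : (F (z.1 + 1, z.2)).1 - (F z).1 = (F (0 + 1, 0)).1 - (F (0, 0)).1.
  apply: (int_valued_const_plane (f := fun z => (F (z.1 + 1, z.2)).1 - (F z).1)).
    move=> {}z; apply: cvgB; last exact: cF1.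
    apply: (continuous_compT (f := fun z : R * R => (z.1 + 1, z.2)) _ cF1).
    apply: continuous_pair => w; last exact: cvg_snd.
    by apply: cvgD; [exact: cvg_fst|exact: cvg_cst].
  move=> {}z.
  have : torus_proj (F (z.1 + 1, z.2)) = torus_proj (F z).
    by rewrite !Ff /torus_proj /= pi1.
  by move=> /torus_proj_eq[k [m ->]] /=; rewrite addrAC subrr add0r intr_int.
have := H (x, y) => /=.
suff -> : (F (0 + 1, 0)).1 - (F (0, 0)).1 = 1 by lra.
rewrite add0r.
have := homotopic_degree hf (c := fun x => (pi x, pi 0)) (p := fst)
  (k0 := fun x => (F (x, 0)).1) (k1 := id).
rewrite subr0; apply => //.
- apply: continuous_pair; first exact: circle_proj_continuous.
  by move=> z; exact: cvg_cst.
- by rewrite -{1}[1]add0r pi1.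
- by move=> z; exact: cvg_fst.
- apply: (continuous_compT (f := fun x : R => (x, 0)) _ cF1).
  by apply: continuous_pair => z; [exact: cvg_id|exact: cvg_cst].
- move=> z; exact: cvg_id.
- by move=> z; rewrite -[LHS]/((torus_proj (F (z, 0))).1) Ff.
- move=> z; rewrite -[(pi z, pi 0)]/(torus_proj (z, 0)) dehn_twistE.
  by rewrite /= mulr0 addr0.
Qed.

(** Integration of the twist condition along vertical segments. *)
Lemma twist_increment (f : torus R -> torus R) (F : R * R -> R * R) (l : int) :
  plane_lift F f -> C1_plane F -> twist_condition l f ->
  exists2 k : R, 0 < k & forall x y y', y <= y' ->
    k * (y' - y) <= (l%:~R / `|l%:~R|) * ((F (x, y')).1 - (F (x, y)).1).
Proof.
move=> FF [dF _] [k k0 kP]; exists k => // x y y' yy'.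
set s : R := _ / _.
pose h y := (F (x, y)).1.
pose h' y := 'D_(0, 1) (fun w => (F w).1) (x, y).
have dh (t : R) : is_derive t (1 : R) h (h' t).
  have dF1 : derivable (fun w => (F w).1) (x, t) (0, 1).
    apply: diff_derivable.
    apply: (@differentiable_comp _ _ _ _ F fst) => //.
    apply: (@linear_differentiable R (R * R)%type R (@fst R R)) => z.
    exact: cvg_fst.
  pose q (r : R) := r^-1 *: (((fun w => (F w).1) \o shift (x, t)) (r *: (0, 1))
         - (F (x, t)).1).
  have hq (r : R) : r^-1 *: ((h \o shift t) (r *: (1 : R)) - h t) = q r.
    rewrite /q /h /=; congr (_ *: ((F _).1 - _)).
    by congr pair; rewrite /= ?scaler0 ?add0r.
  split.
    exact: (eq_ind_r (fun k : R -> R => cvg (k @ (0 : R)^')) dF1 (funext hq)).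
  exact: (f_equal (fun k : R -> R => lim (k @ (0 : R)^')) (funext hq)).
have [|c _ E] := MVT_segment yy' (fun t _ => dh t).
  apply: continuous_subspaceT => t; apply: differentiable_continuous.
  by apply/derivable1_diffP; case: (dh t).
rewrite -/(h y') -/(h y) E mulrA ler_wpM2r ?subr_ge0//.
exact: ltW (kP F FF (x, c)).
Qed.

End PlaneLifts.

(** * The dynamics in leaf coordinates *)

Section LeafDynamics.
Variable R : realType.
Local Notation pi := (@circle_proj R).

(** The point of abscissa [p.1] on the leaf with parameter [p.2]. *)
Definition leaf_chart (g : R -> R -> R) (p : R * R) : torus R :=
  torus_proj (p.1, g p.2 p.1).

(** The map of the plane of leaf coordinates that sends the leaf [t] to the leaf
    [Psi t], and moves the points of the leaf [t] by [A _ t]. *)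
Definition skew_map (A : R -> R -> R) (Psi : R -> R) (p : R * R) : R * R :=
  (A p.1 p.2, Psi p.2).

(** In leaf coordinates, [f] lifts to a skew product over a lift [Psi] of the
    map induced on the leaves; it is increasing and commutes with the
    translation by one along the leaves, and the twist condition bounds from
    below the drift [s * A x t] across the leaves, where the sign [s] is that
    of the twist. *)
Record leaf_dynamics (f : torus R -> torus R) (g : R -> R -> R)
    (psi : circle R -> circle R) (A : R -> R -> R) (Psi : R -> R) (s c : R)
    : Prop := LeafDynamics {
  ld_conj : forall p, f (leaf_chart g p) = leaf_chart g (skew_map A Psi p);
  ld_continuous : continuous (fun p => A p.1 p.2);
  ld_lt : forall x x' t, x < x' -> A x t < A x' t;
  ld_shift : forall x t (k : int), A (x + k%:~R) t = A x t + k%:~R;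
  ld_base : forall t, pi (Psi t) = psi (pi t);
  ld_base_continuous : continuous Psi;
  ld_base_lt : forall t t', t < t' -> Psi t < Psi t';
  ld_sign : s = 1 \/ s = -1;
  ld_gt0 : 0 < c;
  ld_twist : forall x t t', t <= t' -> c * (t' - t) <= s * (A x t' - A x t) }.

Lemma irrational_no_fixpoint (alpha : R) (t : circle R) :
  irrational alpha -> rotation alpha t <> t.
Proof.
move=> ia; have [x <-] := circle_proj_surj t; rewrite rotationE.
move=> /circle_projP[k xk]; apply: ia.
by exists k%:~R => //; rewrite ratr_int; lra.
Qed.

(** [Psi] is increasing because it is injective and has no fixed point; [A] is
    increasing along the leaves because a lift of [f] is injective and commutes
    with the horizontal translation by one. *)
Lemma leaf_dynamics_exist (f : torus R -> torus R) (alpha : R)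
    (phi : circle R -> circle R -> circle R) (psi : circle R -> circle R) g C :
  Diff1_tw f -> irrational alpha -> leaf_lifts phi g C ->
  induced_leaf_map f phi psi -> bilipschitz_conjugate psi (rotation alpha) ->
  exists A Psi s c, leaf_dynamics f g psi A Psi s c.
Proof.
move=> [[[F FF CF] [f' [fK _ [F' FF' _]]]] [l [l0 hf tw]]] ia gP ind.
move=> [h _ hpsi].
have [cF Ff] := FF.
have Finj := plane_lift_inj fK FF FF'.
have Fshift := dehn_lift_shift FF hf.
have [T [cT gT Tg]] := leaf_index_exists gP.
have pi1 z : pi (z + 1) = pi z by exact: (circle_projD z 1).
pose E (p : R * R) := (p.1, g p.2 p.1).
have cE : continuous E.
  apply: continuous_pair; first by move=> z; exact: cvg_fst.
  exact: leaf_joint_continuous gP.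
pose A x t := (F (E (x, t))).1.
pose Psi t := T (F (E (0, t))).
have piT x t : pi (T (F (E (x, t)))) = psi (pi t).
  have H : circle_graph (phi (psi (pi t))) (f (torus_proj (E (x, t)))).
    rewrite -ind; exists (torus_proj (E (x, t))) => //.
    by rewrite /circle_graph /torus_proj /= (leaf_proj gP).
  move: H; rewrite -Ff /circle_graph /torus_proj /= -[X in pi X = _ -> _]gT.
  by rewrite (leaf_proj gP) => /(leaf_disjoint gP).
have cTE : continuous (fun p => T (F (E p))).
  exact: continuous_compT (continuous_compT cE cF) cT.
have cpair2 (t : R) : continuous (fun x : R => (x, t)).
  by apply: continuous_pair => y; [exact: cvg_id|exact: cvg_cst].
have cpair1 (x : R) : continuous (fun t : R => (x, t)).
  by apply: continuous_pair => y; [exact: cvg_cst|exact: cvg_id].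
(* the leaf reached from [(x, t)] does not depend on [x]: it varies continuously
   with [x], over a fixed point of the circle *)
have TE x t : T (F (E (x, t))) = Psi t.
  have := @lift_diff_const R (fun x => T (F (E (x, t)))) (fun=> Psi t) `|x| x
     (lexx _).
  rewrite subrr => H; apply/subr0_eq; apply: H => y _.
  - exact: (continuous_compT (cpair2 t) cTE).
  - exact: cvg_cst.
  - by rewrite !piT.
have FE p : F (E p) = E (skew_map A Psi p).
  case: p => x t; rewrite /skew_map /= /E /= -{1}(TE x t) gT.
  by rewrite /A /E /= -surjective_pairing.
have cA : continuous (fun p => A p.1 p.2).
  rewrite [X in continuous X](_ : _ = fun p => (F (E p)).1); last first.
    by apply/funext => -[].
  apply: (continuous_compT (continuous_compT cE cF)) => z; exact: cvg_fst.
have cPsi : continuous Psi by exact: (continuous_compT (cpair1 0) cTE).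
have A1 x t : A (x + 1) t = A x t + 1.
  by rewrite /A /E /= (leaf_periodic gP _ _ 1) Fshift.
have Ak t x (k : int) : A (x + k%:~R) t = A x t + 1 * k%:~R.
  exact: (shift_int (f := A ^~ t) (fun x => A1 x t)).
have Einj : injective E.
  by move=> [x t] [x' t'] [-> ] /(leaf_inj gP) ->.
have sinj : injective (skew_map A Psi).
  by move=> p q pq; apply/Einj/Finj; rewrite !FE pq.
have cAx t : continuous (A ^~ t).
  exact: (continuous_compT (cpair2 t) cA).
have Alt t x x' : x < x' -> A x t < A x' t.
  have [||H|H] := @continuous_inj_monotone R (A ^~ t); first exact: cAx.
  - move=> y y' /= yy'; have [//] : (y, t) = (y', t).
    by apply: sinj; rewrite /skew_map /= yy'.
  - exact: H.
  - have := H x (x + 1); rewrite ltrDl ltr01 => /(_ isT).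
    by rewrite A1; lra.
have Asurj t y : exists x, A x t = y.
  pose k := Num.floor (y - A 0 t).
  have /andP[kz zk] : k%:~R <= y - A 0 t < (k + 1)%:~R by exact: floor_itv.
  have h1 : A k%:~R t = A 0 t + k%:~R by rewrite -[X in A X]add0r Ak mul1r.
  have h2 : A (k + 1)%:~R t = A 0 t + (k + 1)%:~R.
    by rewrite -[X in A X]add0r Ak mul1r.
  have kk : k%:~R <= (k + 1)%:~R :> R by rewrite ler_int lerDl.
  have [||x _ xy] := @IVT R (A ^~ t) _ _ y kk; last by exists x.
    exact: continuous_subspaceT.
  by rewrite ge_min le_max h1 h2; apply/andP; split; apply/orP; [left|right]; lra.
have psi_nofix t : psi t <> t.
  move=> ft; have := congr1 (@^~ t) hpsi; rewrite /= ft => /esym.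
  exact: irrational_no_fixpoint.
have Psi_nofix t : Psi t <> t.
  by move=> ft; apply: (psi_nofix (pi t)); rewrite -(piT 0 t) -/(Psi t) ft.
have Psilt t t' : t < t' -> Psi t < Psi t'.
  have [|H|H] := @continuous_inj_monotone R Psi cPsi.
  - move=> u u' uu'; have [x xA] := Asurj u (A 0 u').
    by have [] // : (x, u) = (0, u') by apply: sinj; rewrite /skew_map /= xA uu'.
  - exact: H.
  (* a decreasing map of the line has a fixed point *)
  - exfalso; pose v := Psi 0; pose d t := Psi t - t.
    have cd : continuous d by move=> u; apply: cvgB; [exact: cPsi|exact: cvg_id].
    have Hle u u' : u <= u' -> Psi u' <= Psi u.
      by rewrite le_eqVlt => /predU1P[->//|/H/ltW].
    have [v0|/ltW v0] := leP 0 v.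
      have h1 := Hle _ _ v0; rewrite -/v in h1.
      have [||x _ xd] := @IVT R d 0 v 0 v0; first exact: continuous_subspaceT.
        rewrite ge_min le_max /d -/v.
        by apply/andP; split; apply/orP; [right|left]; lra.
      by apply: (Psi_nofix x); apply/subr0_eq.
    have h1 := Hle _ _ v0; rewrite -/v in h1.
    have [||x _ xd] := @IVT R d v 0 0 v0; first exact: continuous_subspaceT.
      rewrite ge_min le_max /d -/v.
      by apply/andP; split; apply/orP; [right|left]; lra.
    by apply: (Psi_nofix x); apply/subr0_eq.
have [k k0 kP] := twist_increment FF CF tw.
have C0 := leaf_gt0 gP.
exists A, Psi, (l%:~R / `|l%:~R|), (k / C); split => //.
- by move=> p; rewrite /leaf_chart -[X in f (torus_proj X)]/(E p) -Ff FE.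
- by move=> x x' t; exact: Alt.
- by move=> x t j; rewrite Ak mul1r.
- by move=> t; exact: piT.
- have lR : l%:~R != 0 :> R by rewrite intr_eq0.
  have [l1|l1] := leP 0 (l%:~R : R).
    by left; rewrite ger0_norm// divff.
  by right; rewrite ltr0_norm// invrN mulrN divff.
- by rewrite divr_gt0.
- move=> x t t' tt'.
  have h1 := leaf_ge gP x tt'.
  have h2 : g t x <= g t' x.
    by rewrite -subr_ge0; apply: le_trans h1; rewrite divr_ge0 ?subr_ge0// ltW.
  apply: le_trans (kP x _ _ h2); rewrite -mulrA; apply: ler_wpM2l.
    exact: ltW.
  by rewrite mulrC.
Qed.

End LeafDynamics.

(** * The area of curvilinear boxes *)

Section TorusArea.
Variable R : realType.
Local Notation pi := (@circle_proj R).
Local Notation mu := (@lebesgue_measure R).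

Lemma open_box (O : set (R * R)) (z : R * R) : open O -> O z ->
  exists2 e : R, 0 < e & forall w, `|z.1 - w.1| < e -> `|z.2 - w.2| < e -> O w.
Proof.
move=> oO Oz; have /nbhs_ballP[e /= e0 eO] : nbhs z O by exact: open_nbhs_nbhs.
by exists e => // w w1 w2; apply: eO; split.
Qed.

Lemma open_measurable_plane (O : set (R * R)) : open O ->
  measurable (O : set (measurableTypeR R * measurableTypeR R)).
Proof.
move=> oO.
pose box (q : (rat * rat) * (rat * rat)) : set (R * R) :=
  `]ratr q.1.1, ratr q.1.2[ `*` `]ratr q.2.1, ratr q.2.2[.
rewrite [X in measurable X](_ : _ = \bigcup_q
   (if `[< box q `<=` O >] then box q else set0)); last first.
  apply/seteqP; split=> [z Oz|z [q _]]; last by case: asboolP => // /[apply].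
  have [e e0 eO] := open_box oO Oz.
  have h (x : R) : exists q : rat * rat, [/\ x - e < ratr q.1, ratr q.1 < x,
      x < ratr q.2 & ratr q.2 < x + e].
    have [|q1] := @rat_in_itvoo R (x - e) x; first by lra.
    have [|q2] := @rat_in_itvoo R x (x + e); first by lra.
    by rewrite !in_itv /= => /andP[? ?] /andP[? ?]; exists (q1, q2).
  have [q1 [a1 a2 a3 a4]] := h z.1; have [q2 [b1 b2 b3 b4]] := h z.2.
  exists (q1, q2) => //=; case: asboolP => [_|nO].
    by split; rewrite /= in_itv /= ?a2 ?b2.
  exfalso; apply: nO => w [] /=; rewrite !in_itv /= => /andP[? ?] /andP[? ?].
  by apply: eO; rewrite ltr_norml; apply/andP; split; lra.
apply: countable_bigcupT_measurable => [|q]; first exact: countableP.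
case: asboolP => // _; apply: measurableX; exact: measurable_itv.
Qed.

Lemma torus_proj_continuous : continuous (@torus_proj R).
Proof.
apply: (@continuous_pair _ _ _ (fun z : R * R => pi z.1) (fun z => pi z.2)).
  by apply: continuous_compT (@circle_proj_continuous R) => z; exact: cvg_fst.
by apply: continuous_compT (@circle_proj_continuous R) => z; exact: cvg_snd.
Qed.

Lemma torus_proj_open (O : set (R * R)) : open O -> open (@torus_proj R @` O).
Proof.
move=> oO; rewrite openE => _ [z Oz <-].
have [e e0 eO] := open_box oO Oz.
exists (pi @` ball z.1 e, pi @` ball z.2 e).
  by split; apply: open_nbhs_nbhs; split;
    [apply: circle_proj_open; exact: ball_open|eexists => //; exact: ballxx
    |apply: circle_proj_open; exact: ball_open|eexists => //; exact: ballxx].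
move=> [_ _] /= [[x xz <-] [y yz <-]].
by exists (x, y) => //; exact: eO.
Qed.

Lemma measurable_arc (a b : R) :
  measurable (pi @^-1` (pi @` `]a, b[) : set (measurableTypeR R)).
Proof.
apply: open_measurable; move/continuousP: (@circle_proj_continuous R); apply.
by apply: circle_proj_open; exact: interval_open.
Qed.

(** Seen in the fundamental domain, an arc of length at most one keeps its
    length, although it may be cut in two. *)
Lemma lebesgue_measure_arc (a b : R) : a <= b -> b <= a + 1 ->
  mu (`[0, 1[ `&` pi @^-1` (pi @` `]a, b[)) = (b - a)%:E.
Proof.
move=> ab ba1.
pose k := Num.floor a.
have /andP[ka ak] : k%:~R <= a < (k + 1)%:~R by exact: floor_itv.
rewrite intrD in ak.
have pik (x : R) : pi (x + k%:~R) = pi x by exact: circle_projD.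
have [b1|b1] := leP (b - k%:~R) 1.
  rewrite (_ : _ `&` _ = `](a - k%:~R), (b - k%:~R)[%classic); last first.
    apply/seteqP; split => [y [/= y01 [w wab /circle_projP[j wj]]]|y /= yab].
      move: y01 wab; rewrite /= !in_itv /= wj => /andP[y0 y1] /andP[aw wb].
      have j1 : -1 < j - k by rewrite -(ltr_int R) intrD !mulrNz mulr1z; lra.
      have j2 : j - k < 1 by rewrite -(ltr_int R) intrD mulrNz ?mulr1z; lra.
      have jk : k = j by lia.
      by rewrite /= ?in_itv /= jk; apply/andP; split; lra.
    move: yab; rewrite in_itv /= => /andP[ay yb]; split.
      by rewrite /= ?in_itv /=; apply/andP; split; lra.
    exists (y + k%:~R) => //=; rewrite ?in_itv /=; apply/andP; split; lra.
  rewrite lebesgue_measure_itv /= lte_fin; case: ltP => h.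
    by rewrite -EFinD; congr EFin; ring.
  by congr EFin; lra.
rewrite (_ : _ `&` _ = `](a - k%:~R), 1[%classic `|`
    `[0, ((b - k%:~R) - 1)[%classic); last first.
  apply/seteqP; split => [y [/= y01 [w wab /circle_projP[j wj]]]|y /= yab].
    move: y01 wab; rewrite /= !in_itv /= wj => /andP[y0 y1] /andP[aw wb].
    have j1 : -1 < j - k by rewrite -(ltr_int R) intrD !mulrNz mulr1z; lra.
    have j2 : j - k < 2 by rewrite -(ltr_int R) intrD mulrNz ?mulr1z; lra.
    have [jk|jk] : j = k \/ j = k + 1 by lia.
      by left; rewrite jk in aw wb; rewrite /= ?in_itv /=; apply/andP; split; lra.
    by right; rewrite jk intrD in aw wb; rewrite /= ?in_itv /=; apply/andP; split; lra.
  move: yab; rewrite !in_itv /= => -[] /andP[ay yb]; split.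
  - by rewrite /= ?in_itv /=; apply/andP; split; lra.
  - by exists (y + k%:~R) => //=; rewrite ?in_itv /=; apply/andP; split; lra.
  - by rewrite /= ?in_itv /=; apply/andP; split; lra.
  - exists (y + (k + 1)%:~R) => //=; last exact: circle_projD.
    by rewrite ?in_itv /= intrD; apply/andP; split; lra.
rewrite measureU//=; last first.
  apply/seteqP; split => // y [] /=; rewrite !in_itv /= => /andP[? ?] /andP[? ?].
  by lra.
rewrite !lebesgue_measure_itv /= !lte_fin ifT; last by lra.
by rewrite ifT -?EFinD; [congr EFin; ring|lra].
Qed.


(** A curvilinear rectangle of the torus, bounded by two leaves. *)
Definition leaf_box (g : R -> R -> R) (a b u v : R) : set (torus R) :=
  @torus_proj R @` [set z | a < z.1 < b /\ g u z.1 < z.2 < g v z.1].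

Lemma leaf_box_open phi g (C a b u v : R) :
  leaf_lifts phi g C -> open (leaf_box g a b u v).
Proof.
move=> gP; apply: torus_proj_open.
have cg t : continuous (fun z : R * R => g t z.1).
  apply: continuous_compT (leaf_continuous gP (t := t)) => z; exact: cvg_fst.
have lt_open (f h : R * R -> R) : continuous f -> continuous h ->
    open [set z | f z < h z].
  move=> cf ch; rewrite [X in open X](_ : _ = (fun z => h z - f z) @^-1` `]0, +oo[).
    have /continuousP : continuous (fun z => h z - f z).
      by move=> z; apply: cvgB; [exact: ch|exact: cf].
    by apply; exact: interval_open.
  by apply/seteqP; split => z /=; rewrite in_itv /= andbT subr_gt0.
have c1 : continuous (fun z : R * R => z.1) by move=> z; exact: cvg_fst.
have c2 : continuous (fun z : R * R => z.2) by move=> z; exact: cvg_snd.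
have cc (y : R) : continuous (fun z : R * R => y) by move=> z; exact: cvg_cst.
rewrite [X in open X](_ : _ = ([set z | a < z.1] `&` [set z | z.1 < b]) `&`
   ([set z | g u z.1 < z.2] `&` [set z | z.2 < g v z.1])).
  by apply: openI; apply: openI; exact: lt_open.
apply/seteqP; split => z /=; first by move=> [/andP[? ?] /andP[? ?]].
by move=> [[-> ->] [-> ->]].
Qed.

Lemma leaf_box_section phi g (C a b u v x y : R) : leaf_lifts phi g C ->
  leaf_box g a b u v (torus_proj (x, y)) <->
  (pi @` `]a, b[) (pi x) /\ (pi @` `](g u x), (g v x)[) (pi y).
Proof.
move=> gP; split=> [[z [zab zuv] [zx zy]]|[[x' x'ab x'x] [y' y'uv y'y]]].
  split; first by exists z.1.
  exists z.2 => //; have /circle_projP[k zk] := zx.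
  by rewrite /= in_itv /=; move: zuv; rewrite zk !(leaf_periodic gP).
exists (x', y'); last by rewrite /torus_proj /= x'x y'y.
have /circle_projP[k x'k] := x'x.
move: y'uv; rewrite /= in_itv /= => y'uv.
by split => //=; rewrite x'k !(leaf_periodic gP).
Qed.

(** By integrating the lengths of the vertical sections: the area of a box is
    comparable to its length times the width of its trace on the axis. *)
Lemma leaf_box_area phi g (C a b u v : R) : leaf_lifts phi g C ->
  a <= b -> b <= a + 1 -> u <= v -> v <= u + 1 ->
  (((b - a) * ((v - u) / C))%:E <= torus_lebesgue (leaf_box g a b u v)
     <= ((b - a) * (C * (v - u)))%:E)%E.
Proof.
move=> gP ab ba1 uv vu1.
set B := leaf_box g a b u v.
pose A : set (measurableTypeR R * measurableTypeR R) :=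
  (`[0, 1[ `*` `[0, 1[) `&` @torus_proj R @^-1` B.
have mA : measurable A.
  apply: measurableI; first by apply: measurableX; exact: measurable_itv.
  apply: open_measurable_plane; move/continuousP: torus_proj_continuous; apply.
  exact: leaf_box_open gP.
pose X : set (measurableTypeR R) := `[0, 1[ `&` pi @^-1` (pi @` `]a, b[).
have mX : measurable X.
  by apply: measurableI; [exact: measurable_itv|exact: measurable_arc].
have muX : mu X = (b - a)%:E by exact: lebesgue_measure_arc.
have C0 := leaf_gt0 gP.
have sec x : mu (xsection A x) = ((g v x - g u x) * \1_X x)%:E.
  have [xX|xX] := boolP (x \in X).
    rewrite indicE xX mulr1.
    have guv : g u x <= g v x.
      rewrite -subr_ge0; apply: le_trans (leaf_ge gP x uv).
      by rewrite divr_ge0 ?subr_ge0// ltW.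
    have gvu1 : g v x <= g u x + 1.
      have := leaf_ge gP x vu1; rewrite (leaf_shift gP _ _ 1) => h.
      by rewrite -subr_ge0; apply: le_trans h; rewrite divr_ge0 ?subr_ge0// ltW.
    rewrite -(lebesgue_measure_arc guv gvu1); congr (mu _).
    move: xX; rewrite inE => -[x01 xab].
    apply/seteqP; split => y.
      rewrite /xsection /= inE => -[[_ y01]].
      by move=> /(leaf_box_section a b u v x y gP)[].
    move=> [y01 yuv]; rewrite /xsection /= inE; split => //.
    exact/(leaf_box_section a b u v x y gP).
  rewrite indicE (negbTE xX) mulr0 (_ : xsection A x = set0) ?measure0//.
  apply/seteqP; split => // y; rewrite /xsection /= inE => -[[x01 _]].
  move=> /(leaf_box_section a b u v x y gP)[xab _].
  by move/negP: xX; apply; rewrite inE.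
have E : torus_lebesgue B = (\int[mu]_x ((g v x - g u x) * \1_X x)%:E)%E.
  by rewrite /torus_lebesgue /product_measure1; apply: eq_integral => x _; exact: sec.
have mf : measurable_fun setT (fun x => ((g v x - g u x) * \1_X x)%:E).
  have := measurable_fun_xsection mu mA.
  by apply: eq_measurable_fun => x _ /=; rewrite sec.
have mk (k : R) : measurable_fun setT (fun x => (k%:E * (\1_X x)%:E)%E).
  apply: measurable_funeM; apply/measurable_EFinP; exact: measurable_indic.
have ik (k : R) : 0 <= k -> (\int[mu]_x (k%:E * (\1_X x)%:E) = ((b - a) * k)%:E)%E.
  move=> k0; rewrite ge0_integralZl_EFin//.
  - have -> : (\int[mu]_x (\1_X x)%:E = (b - a)%:E)%E.
      by rewrite integral_indic// setIT; exact: muX.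
    by rewrite -EFinM mulrC.
  - by apply/measurable_EFinP; exact: measurable_indic.
have i0 x : 0 <= \1_X x :> R by rewrite indicE ler0n.
have uv0 : 0 <= (v - u) / C by rewrite divr_ge0 ?subr_ge0// ltW.
have g0 x : 0 <= g v x - g u x.
  by apply: le_trans (leaf_ge gP x uv).
rewrite E; apply/andP; split.
  rewrite -ik//; apply: ge0_le_integral => // x _.
  - by rewrite -EFinM lee_fin mulr_ge0.
  - by rewrite -EFinM lee_fin ler_wpM2r// (leaf_ge gP).
rewrite -ik; last by rewrite mulr_ge0 ?subr_ge0// ltW.
apply: ge0_le_integral => // x _.
- by rewrite lee_fin mulr_ge0.
- by rewrite -EFinM lee_fin ler_wpM2r// (leaf_le gP).
Qed.

End TorusArea.

(** * Uniform estimates along the orbits *)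

Section Equicontinuity.
Variable R : realType.
Local Notation pi := (@circle_proj R).

Lemma rotation_dist (alpha : R) (a b : circle R) :
  circle_dist (rotation alpha a) (rotation alpha b) = circle_dist a b.
Proof.
have [x <-] := circle_proj_surj a; have [y <-] := circle_proj_surj b.
rewrite !rotationE; apply/eqP; rewrite eq_le; apply/andP; split.
  have [k -> _] := circle_dist_attained x y.
  apply: le_trans (circle_dist_le _ _ k) _.
  by rewrite (_ : x + alpha - _ - _ = x - y - k%:~R)//; ring.
have [k -> _] := circle_dist_attained (x + alpha) (y + alpha).
apply: le_trans (circle_dist_le _ _ k) _.
by rewrite (_ : x + alpha - _ - _ = x - y - k%:~R)//; ring.
Qed.

(** All the iterates of [psi] are bi-Lipschitz, with the same constant [L]. *)
Definition uniformly_bilipschitz (psi : circle R -> circle R) (L : R) :=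
  forall n a b, L^-1 * circle_dist a b <= circle_dist (iter n psi a) (iter n psi b)
    <= L * circle_dist a b.

Lemma iter_conj (T U : Type) (f : T -> T) (g : U -> U) (h : T -> U) :
  (forall x, h (f x) = g (h x)) -> forall n x, h (iter n f x) = iter n g (h x).
Proof. by move=> hfg; elim=> [//|n IH] x; rewrite !iterS hfg IH. Qed.

Lemma bilipschitz_conjugate_iter (psi : circle R -> circle R) (alpha : R) :
  bilipschitz_conjugate psi (rotation alpha) ->
  exists2 L : R, 0 < L & uniformly_bilipschitz psi L.
Proof.
move=> [h [_ [L L0 hL]] hpsi]; exists (L * L); first exact: mulr_gt0.
move=> n a b.
have E x : h (iter n psi x) = iter n (rotation alpha) (h x).
  by apply: iter_conj => y; exact: (congr1 (@^~ y) hpsi).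
have Rn x y : circle_dist (iter n (rotation alpha) x) (iter n (rotation alpha) y)
    = circle_dist x y.
  by elim: n {E} => [//|n IH]; rewrite !iterS rotation_dist.
have /andP[h1 h2] := hL a b.
have /andP[h3 h4] := hL (iter n psi a) (iter n psi b).
rewrite !E Rn in h3 h4; apply/andP; split.
  rewrite invfM -mulrA; apply: le_trans (_ : L^-1 * circle_dist (h a) (h b) <= _).
    by rewrite ler_wpM2l// invr_ge0 ltW.
  by rewrite ler_pdivrMl.
rewrite -mulrA; apply: le_trans (_ : L * circle_dist (h a) (h b) <= _).
  by rewrite -ler_pdivrMl.
by rewrite ler_wpM2l// ltW.
Qed.

End Equicontinuity.

Section TorusMeasure.
Variable R : realType.
Local Notation mu := (@lebesgue_measure R).

Lemma torus_lebesgue_le (B B' : set (torus R)) : open B -> open B' ->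
  B `<=` B' -> (torus_lebesgue B <= torus_lebesgue B')%E.
Proof.
move=> oB oB' BB'; rewrite /torus_lebesgue.
have mA (U : set (torus R)) : open U ->
    measurable ((`[0, 1[ `*` `[0, 1[) `&` @torus_proj R @^-1` U
      : set (measurableTypeR R * measurableTypeR R)).
  move=> oU; apply: measurableI; first by apply: measurableX; exact: measurable_itv.
  by apply: open_measurable_plane; move/continuousP: (@torus_proj_continuous R); apply.
apply: le_measure; rewrite ?inE; [exact: mA|exact: mA|].
by apply: setIS => z; exact: BB'.
Qed.

Lemma plane_lift_continuous (f : torus R -> torus R) F :
  plane_lift F f -> continuous f.
Proof.
move=> [cF Ff]; apply/continuousP => V oV.
rewrite (_ : f @^-1` V =
    @torus_proj R @` ((fun z => torus_proj (F z)) @^-1` V)); last first.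
  apply/seteqP; split => [[a b] Vab|_ [z Vz <-]]; last by rewrite /= -Ff.
  have [x xa] := circle_proj_surj a; have [y yb] := circle_proj_surj b.
  have E : torus_proj (x, y) = (a, b) by rewrite /torus_proj /= xa yb.
  by exists (x, y); rewrite //= Ff E.
apply: torus_proj_open.
have /continuousP : continuous (fun z => torus_proj (F z)).
  exact: continuous_compT cF (@torus_proj_continuous R).
exact.
Qed.

Lemma area_preserving_iter (f : torus R -> torus R) (n : nat) (U : set (torus R)) :
  continuous f -> area_preserving f -> open U ->
  open (iter n f @^-1` U) /\ torus_lebesgue (iter n f @^-1` U) = torus_lebesgue U.
Proof.
move=> cf af oU; elim: n => [//|n [oV IH]].
have E : iter n.+1 f @^-1` U = f @^-1` (iter n f @^-1` U).
  by apply/seteqP; split => x /=; rewrite -iterS iterSr.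
rewrite E; split; first by move/continuousP: cf; apply.
by rewrite af//; exact: sub_sigma_algebra.
Qed.

End TorusMeasure.

Section SkewIterates.
Variable R : realType.
Local Notation pi := (@circle_proj R).
Variables (f : torus R -> torus R) (phi : circle R -> circle R -> circle R)
  (psi : circle R -> circle R) (g A : R -> R -> R) (Psi : R -> R) (C s c L : R).
Hypotheses (gP : leaf_lifts phi g C) (ld : leaf_dynamics f g psi A Psi s c)
  (L0 : 0 < L) (psiL : uniformly_bilipschitz psi L).

(** The position along the leaves after [n] iterations. *)
Definition leafwise (n : nat) (x t : R) := (iter n (skew_map A Psi) (x, t)).1.

Lemma iter_skew_map n x t :
  iter n (skew_map A Psi) (x, t) = (leafwise n x t, iter n Psi t).
Proof.
rewrite [LHS]surjective_pairing; congr pair.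
by apply: (iter_conj (h := snd)).
Qed.

Lemma leafwiseSr n x t : leafwise n.+1 x t = leafwise n (A x t) (Psi t).
Proof. by rewrite /leafwise iterSr. Qed.

Lemma leafwise_chart n x t : iter n f (leaf_chart g (x, t)) =
  leaf_chart g (leafwise n x t, iter n Psi t).
Proof.
rewrite -iter_skew_map; apply/esym/(iter_conj (h := leaf_chart g)) => p.
by rewrite (ld_conj ld).
Qed.

Lemma leafwise_lt n x x' t : x < x' -> leafwise n x t < leafwise n x' t.
Proof.
elim: n x x' t => [//|n IH] x x' t xx'.
by rewrite !leafwiseSr; apply: IH; exact: (ld_lt ld).
Qed.

Lemma leafwise_le n x x' t : x <= x' -> leafwise n x t <= leafwise n x' t.
Proof. by rewrite le_eqVlt => /predU1P[->//|/(leafwise_lt n t)/ltW]. Qed.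

Lemma leafwise_shift n x t (k : int) :
  leafwise n (x + k%:~R) t = leafwise n x t + k%:~R.
Proof. by elim: n x t => [//|n IH] x t; rewrite !leafwiseSr (ld_shift ld) IH. Qed.

Lemma iter_skew_continuous n : continuous (iter n (skew_map A Psi)).
Proof.
elim: n => [|n IH]; first by move=> z; exact: cvg_id.
rewrite [X in continuous X](_ : _ = fun z => skew_map A Psi (iter n (skew_map A Psi) z)).
  apply: (continuous_compT IH); apply: continuous_pair; first exact: (ld_continuous ld).
  apply: continuous_compT (ld_base_continuous ld) => z; exact: cvg_snd.
by apply/funext => z; rewrite iterS.
Qed.

Lemma leafwise_continuous2 n : continuous (fun p => leafwise n p.1 p.2).
Proof.
rewrite [X in continuous X](_ : _ = fun z => (iter n (skew_map A Psi) z).1).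
  by apply: (continuous_compT (@iter_skew_continuous n)) => z; exact: cvg_fst.
by apply/funext => -[].
Qed.

Lemma leafwise_continuousr n x : continuous (leafwise n x).
Proof.
apply: (@continuous_compT _ _ _ (fun t : R => (x, t)) _ _ (@leafwise_continuous2 n)).
by apply: continuous_pair => y; [exact: cvg_cst|exact: cvg_id].
Qed.

Lemma leafwise_continuousl n t : continuous (leafwise n ^~ t).
Proof.
apply: (@continuous_compT _ _ _ (fun x : R => (x, t)) _ _ (@leafwise_continuous2 n)).
by apply: continuous_pair => y; [exact: cvg_id|exact: cvg_cst].
Qed.

Lemma iter_base_lt n t t' : t < t' -> iter n Psi t < iter n Psi t'.
Proof. by elim: n => [//|n IH] /IH h; rewrite !iterS; exact: (ld_base_lt ld). Qed.

Lemma iter_base_continuous n : continuous (iter n Psi).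
Proof.
elim: n => [|n IH]; first by move=> z; exact: cvg_id.
rewrite [X in continuous X](_ : _ = fun z => Psi (iter n Psi z)); last first.
  by apply/funext => z; rewrite iterS.
exact: (continuous_compT IH (ld_base_continuous ld)).
Qed.

Lemma iter_base_proj n t : pi (iter n Psi t) = iter n psi (pi t).
Proof. by apply: iter_conj => u; exact: (ld_base ld). Qed.

(** On the circle, the iterates of the map induced on the leaves are uniformly
    Lipschitz; this passes to their lifts at small distances. *)
Lemma iter_base_le n t t' : t <= t' -> L * (t' - t) < 2^-1 ->
  iter n Psi t' - iter n Psi t <= L * (t' - t).
Proof.
rewrite le_eqVlt => /predU1P[->|tt']; first by rewrite !subrr mulr0.
move=> tL; have d u : t <= u -> circle_dist (pi (iter n Psi u)) (pi (iter n Psi t))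
    <= L * (u - t).
  move=> tu; rewrite !iter_base_proj.
  have /andP[_ h] := psiL n (pi u) (pi t); apply: le_trans h _.
  rewrite ler_wpM2l ?(ltW L0)//; apply: le_trans (circle_dist_leB _ _) _.
  by rewrite ger0_norm ?subr_ge0.
have lt0 := iter_base_lt n tt'.
have [h|h] := leP (iter n Psi t' - iter n Psi t) (2^-1).
  have := d t' (ltW tt'); rewrite circle_dist_small; first by rewrite gtr0_norm ?subr_gt0.
  by rewrite gtr0_norm ?subr_gt0.
(* otherwise an intermediate point would have an image at distance 1/2 *)
have [||u] := @IVT R (iter n Psi) t t' (iter n Psi t + 2^-1) (ltW tt').
- by apply: continuous_subspaceT; exact: iter_base_continuous.
- by rewrite ge_min le_max; apply/andP; split; apply/orP; [left|right]; lra.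
rewrite in_itv /= => /andP[tu ut'] uE.
have := d u tu; rewrite uE circle_dist_small.
  rewrite addrAC subrr add0r ger0_norm ?invr_ge0//.
  have : L * (u - t) <= L * (t' - t) by rewrite ler_wpM2l ?(ltW L0)//; lra.
  lra.
by rewrite addrAC subrr add0r ger0_norm ?invr_ge0.
Qed.

(** Distinct leaves that are less than one apart stay uniformly apart. *)
Lemma iter_base_apart t t' : t < t' -> t' < t + 1 ->
  exists2 k : R, 0 < k & forall n, k <= iter n Psi t' - iter n Psi t.
Proof.
move=> tt' t't1; exists (L^-1 * circle_dist (pi t') (pi t)).
  rewrite mulr_gt0// ?invr_gt0//; apply: circle_dist_gt0 => /circle_projP[k t'E].
  have k0 : 0 < k by rewrite -(ltr_int R); lra.
  have k1 : k < 1 by rewrite -(ltr_int R); lra.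
  by lia.
move=> n; have /andP[h _] := psiL n (pi t') (pi t).
apply: le_trans h _; rewrite -!iter_base_proj.
apply: le_trans (circle_dist_leB _ _) _.
by rewrite gtr0_norm// subr_gt0; exact: iter_base_lt.
Qed.

(** Comparing the area of a thin box along a leaf with that of its image shows
    that the iterates of [f] cannot contract the leaves by more than a fixed
    factor. *)
Lemma leafwise_expansion n a b t : continuous f -> area_preserving f ->
  a <= b -> b < a + 1 ->
  b - a <= C * C * L * (leafwise n b t - leafwise n a t).
Proof.
move=> cf af ab ba1.
have C0 := leaf_gt0 gP.
set K := C * C * L; have K0 : 0 < K by rewrite !mulr_gt0.
set W := leafwise n b t - leafwise n a t.
have W0 : 0 <= W by rewrite subr_ge0; exact: leafwise_le.
have W1 : W < 1.
  by have := leafwise_lt n t ba1; rewrite (leafwise_shift n a t 1) /W; lra.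
rewrite leNgt; apply/negP => KW.
pose eta := Num.min ((1 - W) / 2) ((b - a - K * W) / (4 * K)).
have eta0 : 0 < eta.
  by rewrite lt_min !divr_gt0 ?subr_gt0// mulr_gt0.
have eta1 : W + 2 * eta <= 1.
  have : eta <= (1 - W) / 2 by rewrite ge_min lexx.
  lra.
have etaK : K * (W + 2 * eta) < b - a.
  have : eta <= (b - a - K * W) / (4 * K) by rewrite ge_min lexx orbT.
  rewrite ler_pdivlMr ?mulr_gt0// => h.
  have : 0 < b - a - K * W by lra.
  nra.
have [T [_ gT _]] := leaf_index_exists gP.
have [d d0 dP] : exists2 d : R, 0 < d & forall u, `|t - u| < d ->
    leafwise n a t - eta < leafwise n a u /\
    leafwise n b u < leafwise n b t + eta.
  have h1 : \forall u \near t, `|leafwise n a t - leafwise n a u| < eta.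
    exact: (cvgrPdist_lt _ _).1 (@leafwise_continuousr n a t) _ eta0.
  have h2 : \forall u \near t, `|leafwise n b t - leafwise n b u| < eta.
    exact: (cvgrPdist_lt _ _).1 (@leafwise_continuousr n b t) _ eta0.
  have h12 : nbhs t ([set u | `|leafwise n a t - leafwise n a u| < eta] `&`
      [set u | `|leafwise n b t - leafwise n b u| < eta]) by exact: filterI h1 h2.
  have /nbhs_ballP[d /= d0 dP] := h12.
  exists d => // u /dP[] /=; rewrite !ltr_norml => /andP[? ?] /andP[? ?].
  by split; lra.
(* the box must be thin enough for the ends of its image to move by less than
   [eta], and for [iter_base_le] and [leaf_box_area] to apply *)
pose r := Num.min (d / 2) (Num.min (8^-1) ((8 * L)^-1)).
have r0 : 0 < r by rewrite !lt_min divr_gt0//= !invr_gt0 mulr_gt0// andbT.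
have rd : r < d.
  have : r <= d / 2 by rewrite ge_min lexx.
  lra.
have r8 : r <= 8^-1 by rewrite !ge_min lexx orbT.
have rL : L * (2 * r) < 2^-1.
  have : r <= (8 * L)^-1 by rewrite !ge_min lexx !orbT.
  rewrite invfM ler_pdivlMr//; nra.
pose u := t - r; pose v := t + r.
have vu : v - u = 2 * r by rewrite /v /u; ring.
have uv : u < v by rewrite /u /v; lra.
have uvL : L * (v - u) < 2^-1 by rewrite vu.
have le1 := iter_base_le n (ltW uv) uvL.
have lt1 := iter_base_lt n uv.
set u' := iter n Psi u in le1 lt1; set v' := iter n Psi v in le1 lt1.
(* a box around the image of the thin box, longer by [eta] at both ends *)
pose p := leafwise n a t - eta; pose q := leafwise n b t + eta.
have sub : leaf_box g a b u v `<=` iter n f @^-1` leaf_box g p q u' v'.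
  move=> _ [z [/andP[az zb] /andP[uz zv]] <-] /=.
  have leaf_ltP w w' x : g w x < g w' x -> w < w'.
    move=> h; rewrite ltNge; apply/negP; rewrite le_eqVlt => /predU1P[ww'|].
      by rewrite ww' ltxx in h.
    by move=> /(leaf_lt gP x)/ltW; rewrite leNgt h.
  have uT : u < T z by apply: (leaf_ltP _ _ z.1); rewrite gT.
  have Tv : T z < v by apply: (leaf_ltP _ _ z.1); rewrite gT.
  have -> : torus_proj z = leaf_chart g (z.1, T z).
    by rewrite /leaf_chart /= gT -surjective_pairing.
  have [|h1 h2] := dP (T z).
    by rewrite ltr_norml; rewrite /u in uT; rewrite /v in Tv; apply/andP; split; lra.
  have h3 := leafwise_lt n (T z) az; have h4 := leafwise_lt n (T z) zb.
  rewrite leafwise_chart; eexists; last by [].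
  split => /=; apply/andP; split.
  - by rewrite /p; lra.
  - by rewrite /q; lra.
  - by apply: (leaf_lt gP); exact: iter_base_lt.
  - by apply: (leaf_lt gP); exact: iter_base_lt.
have oB a' b' w w' : open (leaf_box g a' b' w w') by exact: leaf_box_open gP.
have [oU areaU] := area_preserving_iter n cf af (oB p q u' v').
have := torus_lebesgue_le (oB a b u v) oU sub.
rewrite areaU => hle.
have uv1 : v <= u + 1 by lra.
have pq : p <= q by rewrite /p /q; move: W0 eta0; rewrite /W; lra.
have pq1 : q <= p + 1 by rewrite /p /q; move: eta1; rewrite /W; lra.
have uv1' : v' <= u' + 1 by move: le1 uvL; lra.
have /andP[lo _] := leaf_box_area gP ab (ltW ba1) (ltW uv) uv1.
have /andP[_ hi] := leaf_box_area gP pq pq1 (ltW lt1) uv1'.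
have := le_trans lo (le_trans hle hi); rewrite lee_fin.
have -> : q - p = W + 2 * eta by rewrite /q /p /W; ring.
move=> h.
have h1 : C * (v' - u') <= C * (L * (v - u)) by rewrite ler_wpM2l// ltW.
have We : 0 <= W + 2 * eta by lra.
have h2 := le_trans h (ler_wpM2l We h1).
have vu0 : 0 < v - u by rewrite subr_gt0.
move: h2; rewrite mulrA ler_pdivrMr// => h2.
have h3 : (b - a) * (v - u) <= K * (W + 2 * eta) * (v - u).
  by apply: le_trans h2 _; rewrite le_eqVlt; apply/orP; left; apply/eqP; rewrite /K; ring.
rewrite ler_pM2r// in h3; lra.
Qed.

(** The drift across the leaves grows linearly under iteration: the shear
    produced by the first step is at least [c * k], and it is then contracted
    by a bounded factor only. *)
Lemma leafwise_drift (k : R) : continuous f -> area_preserving f -> 0 < k ->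
  exists2 d : R, 0 < d & forall n x t t', t < t' ->
    (forall j, k <= iter j Psi t' - iter j Psi t) ->
    n%:R * d <= s * (leafwise n x t' - leafwise n x t).
Proof.
move=> cf af k0; have c0 := ld_gt0 ld; have C0 := leaf_gt0 gP.
set K := C * C * L; have K0 : 0 < K by rewrite !mulr_gt0.
pose r := Num.min (c * k) (2^-1).
have r0 : 0 < r by rewrite lt_min mulr_gt0//= invr_gt0.
have r2 : r <= 2^-1 by rewrite ge_min lexx orbT.
have rc : r <= c * k by rewrite ge_min lexx.
have gain n y y' t : r <= y' - y -> r / K <= leafwise n y' t - leafwise n y t.
  move=> yy'; have h1 : y + r <= y' by lra.
  have := leafwise_le n t h1.
  have yr : y <= y + r by lra.
  have yr1 : y + r < y + 1 by lra.
  have := leafwise_expansion n t cf af yr yr1.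
  rewrite addrAC subrr add0r => h2 h3.
  by rewrite ler_pdivrMr// mulrC; apply: le_trans h2 _; rewrite ler_wpM2l ?(ltW K0)//; lra.
exists (r / K); first by rewrite divr_gt0.
elim=> [|n IH] x t t' tt' hk.
  by rewrite mul0r /leafwise /= subrr mulr0.
have h1 := ld_twist ld x (ltW tt').
have h2 : r <= s * (A x t' - A x t).
  apply: le_trans rc _; apply: le_trans h1.
  by rewrite ler_wpM2l ?(ltW c0)//; exact: (hk 0%N).
have h3 := IH (A x t) (Psi t) (Psi t') (ld_base_lt ld tt').
rewrite !leafwiseSr.
have {}h3 : n%:R * (r / K) <=
    s * (leafwise n (A x t) (Psi t') - leafwise n (A x t) (Psi t)).
  by apply: h3 => j; have := hk j.+1; rewrite !iterSr.
have h4 : r / K <=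
    s * (leafwise n (A x t') (Psi t') - leafwise n (A x t) (Psi t')).
  by case: (ld_sign ld) h2 => ->; rewrite ?mul1r ?mulN1r ?opprB => /gain.
rewrite -natr1 mulrDl mul1r; lra.
Qed.

End SkewIterates.

(** * Dense orbits on the space of leaves *)

Section RotationOrbits.
Variable R : realType.
Local Notation pi := (@circle_proj R).

(** Dirichlet's pigeonhole argument. *)
Lemma small_multiple (alpha e : R) : 0 < e ->
  exists (q : nat) (p : int), (0 < q)%N /\ `|q%:R * alpha - p%:~R| < e.
Proof.
move=> e0; pose m := Num.truncn e^-1; pose M : R := m.+1%:R.
have M0 : 0 < M by rewrite ltr0n.
have Me : M^-1 < e by rewrite invf_plt ?posrE//; exact: truncnS_gt.
pose fr (i : nat) : R := i%:R * alpha - (Num.floor (i%:R * alpha))%:~R.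
have fr01 i : 0 <= fr i < 1.
  have /andP[h1 h2] := floor_itv (i%:R * alpha); rewrite intrD in h2.
  by rewrite /fr; apply/andP; split; lra.
pose b (i : 'I_m.+2) : 'I_m.+1 := inord (Num.truncn (M * fr i)).
have bE i : (b i : nat) = Num.truncn (M * fr i).
  have /andP[h1 h2] := fr01 i.
  have /andP[h3 _] := truncn_itv (mulr_ge0 (ltW M0) h1).
  by rewrite inordK// -(ltr_nat R); apply: le_lt_trans h3 _; rewrite -/M gtr_pMr.
have close (i j : 'I_m.+2) : b i = b j -> `|fr i - fr j| < e.
  move=> bij; have /andP[i1 i2] := fr01 i; have /andP[j1 j2] := fr01 j.
  have tij : Num.truncn (M * fr i) = Num.truncn (M * fr j) by rewrite -!bE bij.
  have /andP[i3 i4] := truncn_itv (mulr_ge0 (ltW M0) i1).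
  have /andP[j3 j4] := truncn_itv (mulr_ge0 (ltW M0) j1).
  rewrite tij in i3 i4.
  have h : `|M * fr i - M * fr j| < 1.
    by rewrite -natr1 in i4 j4; rewrite ltr_norml; apply/andP; split; lra.
  apply: lt_trans Me; rewrite -mulrBr normrM gtr0_norm// in h.
  by rewrite -[M^-1]mul1r ltr_pdivlMr// mulrC.
have [i [j ij bij]] : exists i, exists2 j, i != j & b i = b j.
  apply/injectivePn/negP => /injectiveP/leq_card.
  by rewrite !card_ord ltnn.
wlog ji : i j ij bij / (j < i)%N => [H|].
  have : (i != j :> nat) by [].
  rewrite neq_ltn => /orP[lt|lt]; last exact: (H i j).
  by apply: (H j i) => //; rewrite eq_sym.
exists (i - j)%N, (Num.floor (i%:R * alpha) - Num.floor (j%:R * alpha)).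
split; first by rewrite subn_gt0.
have := close _ _ bij; rewrite natrB ?(ltnW ji)// intrD mulrNz mulrBl.
set u := _ * alpha; set v := _ * alpha.
rewrite /fr -/u -/v => H; apply: le_lt_trans H.
by rewrite le_eqVlt; apply/orP; left; apply/eqP; congr `|_|; ring.
Qed.

Lemma irrational_orbit_dense (alpha x y e : R) (N : nat) :
  irrational alpha -> 0 < e ->
  exists (n : nat) (k : int), (N <= n)%N /\ `|x + n%:R * alpha - y - k%:~R| < e.
Proof.
move=> ia e0; have [q [p [q0 qe]]] := small_multiple alpha e0.
pose d := q%:R * alpha - p%:~R.
have d0 : d != 0.
  apply/eqP => dE; apply: ia; exists (p%:~R / q%:R) => //.
  rewrite fmorph_div rmorph_int rmorph_nat.
  apply/esym; apply: (canRL (mulfK _)); first by rewrite pnatr_eq0 -lt0n.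
  by rewrite mulrC; apply/subr0_eq.
(* translate the target by an integer so that it lies at least [N] steps ahead
   of [x] in the direction of [d] *)
have [m [j [Nm h]]] : exists (m : nat) (j : int), (N <= m)%N /\
    `|y + j%:~R - x - m%:R * d| < e.
  have [dp|dn] := ltP 0 d.
    pose j := Num.ceil (N%:R * d - (y - x)).
    have hj : N%:R * d - (y - x) <= j%:~R by exact: Num.Theory.ceil_ge.
    pose w := y + j%:~R - x; have wN : N%:R * d <= w by rewrite /w; lra.
    have w0 : 0 <= w / d.
      by rewrite divr_ge0 ?(ltW dp)//; apply: le_trans wN; rewrite mulr_ge0 ?ler0n ?ltW.
    have /andP[m1 m2] := truncn_itv w0.
    exists (Num.truncn (w / d)), j; split.
      by rewrite truncn_ge_nat// ler_pdivlMr.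
    rewrite ler_pdivlMr// in m1; rewrite ltr_pdivrMr// -natr1 mulrDl mul1r in m2.
    have : `|d| < e by [].
    by rewrite -/w gtr0_norm// => de; rewrite ltr_norml; apply/andP; split; lra.
  have dp : 0 < - d by rewrite oppr_gt0 lt_neqAle d0.
  pose j := Num.floor (N%:R * d - (y - x)).
  have hj : j%:~R <= N%:R * d - (y - x) by exact: Num.Theory.floor_le.
  pose w := - (y + j%:~R - x); have wN : N%:R * (- d) <= w.
    by rewrite /w mulrN; lra.
  have w0 : 0 <= w / (- d).
    by rewrite divr_ge0 ?(ltW dp)//; apply: le_trans wN; rewrite mulr_ge0 ?ler0n ?ltW.
  have /andP[m1 m2] := truncn_itv w0.
  exists (Num.truncn (w / - d)), j; split.
    by rewrite truncn_ge_nat// ler_pdivlMr.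
  rewrite ler_pdivlMr// in m1; rewrite ltr_pdivrMr// -natr1 mulrDl mul1r in m2.
  have : `|d| < e by [].
  rewrite ltr0_norm -?oppr_gt0// => de; rewrite -normrN ltr_norml.
  by rewrite mulrN in m1 m2; rewrite /w in m1 m2; apply/andP; split; lra.
exists (m * q)%N, (j + m%:Z * p); split.
  by apply: leq_trans Nm _; rewrite leq_pmulr.
rewrite (_ : x + _ - _ - _ = - (y + j%:~R - x - m%:R * d)) ?normrN//.
by rewrite natrM intrD intrM /d; ring.
Qed.

Lemma conjugate_orbit_dense (psi : circle R -> circle R) (alpha : R)
    (a b : circle R) (e : R) (N : nat) :
  irrational alpha -> bilipschitz_conjugate psi (rotation alpha) -> 0 < e ->
  exists2 n : nat, (N <= n)%N & circle_dist (iter n psi a) b < e.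
Proof.
move=> ia [h [_ [L L0 hL]] hpsi] e0.
have E n x : h (iter n psi x) = iter n (rotation alpha) (h x).
  by apply: iter_conj => y; exact: (congr1 (@^~ y) hpsi).
have [x xE] := circle_proj_surj (h a); have [y yE] := circle_proj_surj (h b).
have rn n : iter n (rotation alpha) (pi x) = pi (x + n%:R * alpha).
  elim: n => [|n IH]; first by rewrite mul0r addr0.
  by rewrite iterS IH rotationE -natr1 mulrDl mul1r addrA.
have [n [k [Nn nk]]] := irrational_orbit_dense x y N ia (divr_gt0 e0 L0).
exists n => //; have /andP[+ _] := hL (iter n psi a) b.
rewrite E -xE -yE rn ler_pdivrMl// => H; apply: le_lt_trans H _.
rewrite mulrC -ltr_pdivlMr//; apply: le_lt_trans nk; exact: circle_dist_le.
Qed.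

(** If finitely many sets have a union that is dense in an interval, then one of
    them is dense in a subinterval. *)
Lemma finite_union_somewhere_dense (S : nat -> set R) (N : nat) (a b : R) :
  a < b ->
  (forall a' b', a <= a' -> a' < b' -> b' <= b ->
     exists i x, [/\ (i < N)%N, S i x & a' < x < b']) ->
  exists i a1 b1, a1 < b1 /\ forall a' b', a1 <= a' -> a' < b' -> b' <= b1 ->
     exists2 x, S i x & a' < x < b'.
Proof.
elim: N a b => [|N IH] a b ab H.
  by have [i [x [//]]] := H a b (lexx _) ab (lexx _).
have [dN|/existsNP[a' /existsNP[b' nd]]] := pselect (forall a' b', a <= a' ->
    a' < b' -> b' <= b -> exists2 x, S N x & a' < x < b').
  by exists N, a, b.
have [aa [ab' [bb nS]]] : [/\ a <= a', a' < b', b' <= b &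
    ~ exists2 x, S N x & a' < x < b'].
  by move: nd => /not_implyP[? /not_implyP[? /not_implyP[? ?]]].
apply: (IH a' b' ab') => u v au uv vb.
have [i [x [iN Six /andP[ux xv]]]] := H u v (le_trans aa au) uv (le_trans vb bb).
exists i, x; split; rewrite ?ux//.
move: iN; rewrite ltnS leq_eqVlt => /predU1P[iN|//].
exfalso; apply: nS; exists x; first by rewrite -iN.
by apply/andP; split; lra.
Qed.

End RotationOrbits.

(** * Density of the orbits *)

Section OrbitInvariance.
Variable R : realType.

(** The points [i / (m + 1)] form a net of the circle. *)
Lemma fraction_near (m : nat) (x : R) :
  exists i (k : int), (i < m.+1)%N /\
    `|x - (i%:R / m.+1%:R + k%:~R)| <= m.+1%:R^-1.
Proof.
have M0 : 0 < m.+1%:R :> R by rewrite ltr0n.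
pose k := Num.floor x; have /andP[k1 k2] := floor_itv x.
rewrite -/k intrD in k1 k2.
have y0 : 0 <= m.+1%:R * (x - k%:~R) by rewrite mulr_ge0 ?subr_ge0// ltW.
have /andP[i1 i2] := truncn_itv y0.
set i := Num.truncn _ in i1 i2.
exists i, k; split.
  rewrite -(ltr_nat R); apply: le_lt_trans i1 _.
  by rewrite gtr_pMr//; lra.
rewrite -natr1 in i2.
rewrite (_ : x - _ = (m.+1%:R * (x - k%:~R) - i%:R) / m.+1%:R); last first.
  by rewrite mulrBl [_ * (x - _)]mulrC mulfK ?gt_eqF//; ring.
rewrite normrM ger0_norm ?subr_ge0// (gtr0_norm (_ : 0 < m.+1%:R^-1)) ?invr_gt0//.
by rewrite ler_piMl ?invr_ge0 ?(ltW M0)//; lra.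
Qed.

Lemma orbit_of_iter_inv (f : torus R -> torus R) (z w : torus R) (n : nat) :
  injective f -> orbit_of f z (iter n f w) -> orbit_of f z w.
Proof.
move=> finj [m [nw|]]; last first.
  by rewrite -iterD => mz; exists (m + n)%N; right.
have iinj k : injective (iter k f).
  by elim: k => [//|k IH] x y /=; move=> /finj/IH.
have [nm|/ltnW mn] := leqP n m.
  exists (m - n)%N; left; apply: (iinj n).
  by rewrite -iterD subnKC.
exists (n - m)%N; right; apply: (iinj m).
by rewrite -iterD subnKC.
Qed.

End OrbitInvariance.

Section Minimality.
Variable R : realType.
Local Notation pi := (@circle_proj R).
Variables (f : torus R -> torus R) (phi : circle R -> circle R -> circle R)
  (psi : circle R -> circle R) (g A : R -> R -> R) (Psi : R -> R)
  (C s c alpha : R).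
Hypotheses (gP : leaf_lifts phi g C) (ld : leaf_dynamics f g psi A Psi s c)
  (cf : continuous f) (finj : injective f) (af : area_preserving f)
  (ia : irrational alpha)
  (psi_conj : bilipschitz_conjugate psi (rotation alpha)).

Lemma leaf_chart_surj z : exists p, leaf_chart g p = z.
Proof.
have [T [_ gT _]] := leaf_index_exists gP.
case: z => a b; have [x xa] := circle_proj_surj a; have [y yb] := circle_proj_surj b.
by exists (x, T (x, y)); rewrite /leaf_chart /= (gT (x, y)) /torus_proj /= xa yb.
Qed.

Lemma leaf_chart_continuous : continuous (leaf_chart g).
Proof.
apply: continuous_compT (@torus_proj_continuous R).
apply: continuous_pair; first by move=> z; exact: cvg_fst.
exact: leaf_joint_continuous gP.
Qed.

Lemma leaf_chart_shift x t (k l : int) :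
  leaf_chart g (x + k%:~R, t + l%:~R) = leaf_chart g (x, t).
Proof.
rewrite /leaf_chart /torus_proj /= (leaf_periodic gP) (leaf_shift gP).
by rewrite !circle_projD.
Qed.

(** The leaf parameters of a forward orbit are dense. *)
Lemma orbit_leaves_dense (z : torus R) (t e : R) : 0 < e ->
  exists x u, orbit_of f z (leaf_chart g (x, u)) /\ `|u - t| < e.
Proof.
move=> e0; have [[x0 t0] zE] := leaf_chart_surj z.
have [n _ nt] := conjugate_orbit_dense (pi t0) (pi t) 0 ia psi_conj e0.
rewrite -(iter_base_proj ld) in nt.
have [k kE _] := circle_dist_attained (iter n Psi t0) t.
exists (leafwise A Psi n x0 t0), (iter n Psi t0 - k%:~R); split; last first.
  by rewrite kE in nt; rewrite addrAC.
exists n; left; rewrite -zE (leafwise_chart ld) -[in RHS](leaf_chart_shift _ _ 0 (- k)).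
by rewrite addr0 mulrNz.
Qed.

Lemma leaf_dynamics_minimal : minimal f.
Proof.
move=> z O [w Ow] oO; apply: contrapT => Oorb.
have {}Oorb p : O (leaf_chart g p) -> orbit_of f z (leaf_chart g p) -> False.
  by move=> Op zp; apply: Oorb; exists (leaf_chart g p).
have C0 := leaf_gt0 gP.
have [L L0 psiL] := bilipschitz_conjugate_iter psi_conj.
have [[x0 t0] wE] := leaf_chart_surj w.
have [e e0 eO] : exists2 e : R, 0 < e & forall q, `|x0 - q.1| < e ->
    `|t0 - q.2| < e -> O (leaf_chart g q).
  apply: (@open_box R (leaf_chart g @^-1` O) (x0, t0)); last by rewrite /= wE.
  by move/continuousP: leaf_chart_continuous; apply.
set lw := leafwise A Psi.
set K := C * C * L; have K0 : 0 < K by rewrite !mulr_gt0.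
(* a box around the given point of [O], of half-width [rho] along the leaves *)
pose rho := Num.min (e / 2) (2^-1).
have rho0 : 0 < rho by rewrite lt_min divr_gt0//= invr_gt0.
have rho1 : rho <= 2^-1 by rewrite ge_min lexx orbT.
have rhoe : rho < e.
  have : rho <= e / 2 by rewrite ge_min lexx.
  lra.
pose eps := rho / K; have eps0 : 0 < eps by rewrite divr_gt0.
have thick n x t : lw n x t + eps <= lw n (x + rho) t.
  have h1 : x <= x + rho by lra.
  have h2 : x + rho < x + 1 by lra.
  have := leafwise_expansion gP ld L0 psiL n t cf af h1 h2.
  rewrite addrAC subrr add0r -/K mulrC -ler_pdivrMr// -/eps -/lw; lra.
pose m := Num.truncn (2 / eps).
have mE : m.+1%:R^-1 < eps / 2.
  rewrite invf_plt ?posrE ?divr_gt0// ?ltr0n// invf_div; exact: truncnS_gt.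
(* finitely many arcs of length [eps] cover the leaves; the orbit meets one of them
   on a somewhere dense set of leaves *)
pose S (i : nat) : set R := [set u | exists2 x,
  `|x - i%:R / m.+1%:R| < eps / 2 & orbit_of f z (leaf_chart g (x, u))].
have [i [j1 [j2 [j12 Sd]]]] : exists i a1 b1, a1 < b1 /\ forall a' b',
    a1 <= a' -> a' < b' -> b' <= b1 -> exists2 x, S i x & a' < x < b'.
  apply: (@finite_union_somewhere_dense R S m.+1 0 1) => // a b _ ab _.
  have [|x [u [zu ut]]] := @orbit_leaves_dense z ((a + b) / 2) ((b - a) / 2).
    by rewrite divr_gt0 ?subr_gt0.
  have [i [k [im ik]]] := fraction_near m x.
  exists i, u; split => //; last first.
    by rewrite ltr_norml in ut; move: ut => /andP[? ?]; apply/andP; split; lra.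
  exists (x - k%:~R).
    apply: le_lt_trans mE; apply: le_trans ik.
    by rewrite le_eqVlt; apply/orP; left; apply/eqP; congr `|_|; ring.
  by have := leaf_chart_shift x u (- k) 0; rewrite addr0 mulrNz => ->.
pose tm := (j1 + j2) / 2; pose wd := (j2 - j1) / 4.
have wd0 : 0 < wd by rewrite divr_gt0 ?subr_gt0.
pose r := Num.min (e / 2) (Num.min (4^-1) (Num.min (wd / (2 * L)) ((8 * L)^-1))).
have r0 : 0 < r.
  have h8 : 0 < 8 * L by rewrite mulr_gt0.
  have h2 : 0 < 2 * L by rewrite mulr_gt0.
  by rewrite !lt_min (divr_gt0 e0)// (divr_gt0 wd0)// !invr_gt0 h8 ltr0n.
have re : r < e.
  have : r <= e / 2 by rewrite ge_min lexx.
  lra.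
have r4 : r <= 4^-1 by rewrite !ge_min lexx !orbT.
have rw : L * r < wd.
  have : r <= wd / (2 * L) by rewrite !ge_min lexx !orbT.
  rewrite ler_pdivlMr ?mulr_gt0//; nra.
have rL : L * r < 4^-1.
  have : r <= (8 * L)^-1 by rewrite !ge_min lexx !orbT.
  rewrite -[(8 * L)^-1]mul1r ler_pdivlMr ?mulr_gt0//; nra.
have rL2 : L * r < 2^-1 by lra.
pose t1 := t0 - r; pose t2 := t0 + r.
have t12 : t1 < t2 by rewrite /t1 /t2; lra.
have t21 : t2 < t1 + 1 by rewrite /t1 /t2; lra.
have [kap kap0 kapP] := iter_base_apart ld L0 psiL t12 t21.
have [d d0 dP] := leafwise_drift gP ld L0 psiL cf af kap0.
pose N := (Num.truncn d^-1).+1.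
have [n Nn nt] := conjugate_orbit_dense (pi t0) (pi tm) N ia psi_conj wd0.
rewrite -(iter_base_proj ld) in nt.
have [k kE _] := circle_dist_attained (iter n Psi t0) tm.
rewrite kE ltr_norml in nt.
(* the images of the leaves of the box lie in the interval where [S i] is dense *)
have t1J : j1 < iter n Psi t1 - k%:~R.
  have h1 : t1 <= t0 by rewrite /t1; lra.
  have h2 : L * (t0 - t1) = L * r by rewrite /t1; congr (_ * _); ring.
  have := iter_base_le ld L0 psiL n h1; rewrite h2.
  by move=> /(_ rL2); move: nt rw; rewrite /tm /wd => /andP[? ?]; lra.
have t2J : iter n Psi t2 - k%:~R < j2.
  have h1 : t0 <= t2 by rewrite /t2; lra.
  have h2 : L * (t2 - t0) = L * r by rewrite /t2; congr (_ * _); ring.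
  have := iter_base_le ld L0 psiL n h1; rewrite h2.
  by move=> /(_ rL2); move: nt rw; rewrite /tm /wd => /andP[? ?]; lra.
(* the image of the vertical segment through [(x0, t0)] winds around the leaves *)
have drift : 1 <= s * (lw n x0 t2 - lw n x0 t1).
  apply: le_trans (dP n x0 t1 t2 t12 kapP).
  have : d^-1 < N%:R by exact: truncnS_gt.
  have : N%:R <= n%:R :> R by rewrite ler_nat.
  by rewrite -(ler_pdivrMr _ _ d0) mul1r; lra.
pose q : R := i%:R / m.+1%:R.
have clw : continuous (lw n x0) by exact: (@leafwise_continuousr _ _ _ _ _ _ _ _ ld n x0).
have [t [l [tt tE]]] : exists t (l : int), t1 <= t <= t2 /\ lw n x0 t = q + l%:~R.
  pose lo := Num.min (lw n x0 t1) (lw n x0 t2).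
  pose l := Num.ceil (lo - q).
  have /andP[l1 l2] := Num.Theory.ceil_itv (lo - q).
  rewrite -/l intrD mulrN1z in l1 l2.
  have [||t] := @IVT R (lw n x0) t1 t2 (q + l%:~R) (ltW t12).
  - exact: continuous_subspaceT.
  - have -> : Num.max (lw n x0 t1) (lw n x0 t2) =
        lo + `|lw n x0 t2 - lw n x0 t1|.
      rewrite /lo; have [h|h] := leP (lw n x0 t1) (lw n x0 t2).
        by rewrite ger0_norm ?subr_ge0//; ring.
      by rewrite ltr0_norm ?subr_lt0//; ring.
    have h : 1 <= `|lw n x0 t2 - lw n x0 t1|.
      apply: le_trans drift _; apply: le_trans (ler_norm _) _.
      by rewrite normrM; case: (ld_sign ld) => ->; rewrite ?normrN normr1 mul1r.
    by rewrite -/lo; apply/andP; split; lra.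
  - by rewrite in_itv /= => tt tE; exists t, l.
(* nearby, some leaf of [S i] is the image of a leaf of the box *)
have [t' [u [tt' tu uS lwt']]] : exists t' u, [/\ t1 <= t' <= t2,
    u = iter n Psi t' - k%:~R, S i u & `|lw n x0 t' - (q + l%:~R)| < eps / 2].
  have eps2 : 0 < eps / 2 by rewrite divr_gt0.
  have [dl dl0 dlP] : exists2 dl : R, 0 < dl & forall v, `|t - v| < dl ->
      `|lw n x0 t - lw n x0 v| < eps / 2.
    have /nbhs_ballP[dl /= dl0 dlP] : \forall v \near t,
        `|lw n x0 t - lw n x0 v| < eps / 2.
      exact: (cvgrPdist_lt _ _).1 (clw t) _ eps2.
    by exists dl => // v /dlP.
  pose a := Num.max t1 (t - dl / 2); pose b := Num.min t2 (t + dl / 2).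
  move: tt => /andP[tt1 tt2].
  have ab : a < b by rewrite lt_min !gt_max; do !(apply/andP; split); lra.
  have a1 : t1 <= a by rewrite le_max lexx.
  have a2 : t - dl / 2 <= a by rewrite le_max lexx orbT.
  have b1 : b <= t2 by rewrite ge_min lexx.
  have b2 : b <= t + dl / 2 by rewrite ge_min lexx orbT.
  have Pab := iter_base_lt ld n ab.
  have mono v v' : v <= v' -> iter n Psi v <= iter n Psi v'.
    by rewrite le_eqVlt => /predU1P[->//|/(iter_base_lt ld n)/ltW].
  have Pa := mono _ _ a1; have Pb := mono _ _ b1.
  have [|||u uS /andP[au ub]] :=
      Sd (iter n Psi a - k%:~R) (iter n Psi b - k%:~R); [lra|lra|lra|].
  have [||t'] := @IVT R (iter n Psi) a b (u + k%:~R) (ltW ab).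
  - by apply: continuous_subspaceT; exact: (@iter_base_continuous _ _ _ _ _ _ _ _ ld n).
  - by rewrite ge_min le_max; apply/andP; split; apply/orP; [left|right]; lra.
  rewrite in_itv /= => /andP[at' t'b] t'E; exists t', u; split => //.
  - by apply/andP; split; lra.
  - by rewrite t'E addrK.
  - rewrite -tE distrC; apply: dlP; rewrite ltr_norml; apply/andP; split; lra.
have [x xq zx] := uS; rewrite -/q in xq.
have [x' x'x x'E] : exists2 x', `|x0 - x'| <= rho & lw n x' t' = x + l%:~R.
  have h1 := thick n x0 t'; have h2 := thick n (x0 - rho) t'.
  rewrite subrK in h2.
  have rr : x0 - rho <= x0 + rho by lra.
  rewrite !ltr_norml in xq lwt'; move: xq lwt' => /andP[? ?] /andP[? ?].
  have [||x'] := @IVT R (lw n ^~ t') (x0 - rho) (x0 + rho) (x + l%:~R) rr.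
  - by apply: continuous_subspaceT; exact: (@leafwise_continuousl _ _ _ _ _ _ _ _ ld n t').
  - by rewrite ge_min le_max; apply/andP; split; apply/orP; [left|right]; lra.
  rewrite in_itv /= => /andP[? ?] x'E; exists x' => //.
  by rewrite ler_norml; apply/andP; split; lra.
apply: (Oorb (x', t')).
  apply: eO => /=; first exact: le_lt_trans rhoe.
  move: tt' => /andP[h1 h2]; rewrite /t1 in h1; rewrite /t2 in h2.
  by rewrite ltr_norml; apply/andP; split; lra.
apply: (@orbit_of_iter_inv R f z _ n) => //.
rewrite (leafwise_chart ld) -/lw x'E -(subrK k%:~R (iter n Psi t')) -tu.
by rewrite leaf_chart_shift.
Qed.

End Minimality.

Unset Implicit Arguments.
Set Strict Implicit.

Theorem theorem3 (R : realType)
    (f : torus R -> torus R) (fhat : annulus R -> annulus R) (alpha : R)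
    (phi : circle R -> circle R -> circle R) (psi : circle R -> circle R) :
  Diff1_tw f ->
  area_preserving f ->
  annulus_lift fhat f ->
  irrational alpha ->
  vertical_rotation_set fhat = [set alpha] ->
  lipschitz_graph_foliation phi ->
  invariant_foliation f phi ->
  lipschitz_foliation phi ->
  induced_leaf_map f phi psi ->
  bilipschitz_conjugate psi (rotation alpha) ->
  minimal f.
Proof.
move=> ftw af _ ia _ hphi _ lphi ind psi_conj.
have [g [C gP]] := leaf_lifts_exist hphi lphi.
have [A [Psi [s [c ld]]]] := leaf_dynamics_exist ftw ia gP ind psi_conj.
have [[[F FF _] [f' [fK _ _]]] _] := ftw.
apply: (leaf_dynamics_minimal gP ld) af ia psi_conj => //.
- exact: plane_lift_continuous FF.
- exact: can_inj fK.
Qed.
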